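(* Let $\alpha,\beta>0$, let $B$ be a one-dimensional Brownian motion, and for $x,y\in\mathbb R$ let $(X^{x,y},Y^{x,y})$ be the solution of $$dX^{x,y}_t=-\alpha X^{x,y}_t\,dt+dB_t,\quad X^{x,y}_0=x,$$ $$dY^{x,y}_t=-\beta Y^{x,y}_t\,dt+X^{x,y}_t\,dt,\quad Y^{x,y}_0=y .$$ Then for all $1$-Lipschitz functions $f\colon\mathbb R\to\mathbb R$ and all $R,T>0$, $$\mathbb P\left(\frac1T\int_0^Tf(Y^{x,y}_t)\,dt-\mathbb E\left[\frac1T\int_0^Tf(Y^{x,y}_t)\,dt\right]\ge R\right)\le\exp\left(\frac{-R^2\,T\,(\alpha\wedge\beta)^2\,|\alpha-\beta|^2}{4\left(1-e^{-(\alpha\wedge\beta)T}\right)^2\left(1-e^{-|\alpha-\beta|T}\right)^2}\right).$$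
   Context: $\alpha\wedge\beta=\min(\alpha,\beta)$.
   Formalization: When α=β the stated bound reads 0/0; there |α−β|/(1−e^{−|α−β|T}) is replaced by its limit 1/T as |α−β|→0. For α≠β the bound is as stated. *)

(* Defs.v *)
From HB Require Import structures.
From mathcomp Require Import all_boot all_order all_algebra.
From mathcomp Require Import all_classical all_reals all_analysis.
(* [all_analysis] does not export the ring structure of [{mfun T >-> R}]. *)
From mathcomp Require Import measurable_realfun.

Set Implicit Arguments.
Unset Strict Implicit.
Unset Printing Implicit Defensive.

Import Order.TTheory GRing.Theory Num.Theory.
Import numFieldNormedType.Exports.

Local Open Scope classical_set_scope.
Local Open Scope ring_scope.

(* The product rule over the whole family covers every subfamily: take
   [A i = setT] for the indices left out. *)
Definition mutually_independent (d : measure_display) (Omega : measurableType d)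
    (R : realType) (P : probability Omega R) (n : nat)
    (Z : 'I_n -> {RV P >-> R}) : Prop :=
  forall A : 'I_n -> set R, (forall i, measurable (A i)) ->
    P (\bigcap_i (Z i @^-1` A i)) = (\prod_(i < n) P (Z i @^-1` A i))%E.

(* Processes are indexed by all of [R]; only the times [t >= 0] are
   constrained or used. *)
Record brownian_motion (d : measure_display) (Omega : measurableType d)
    (R : realType) (P : probability Omega R) (B : R -> {RV P >-> R}) : Prop := {
  brownian_start : {ae P, forall w, B 0 w = 0} ;
  brownian_indep : forall (n : nat) (t : nat -> R),
    0 <= t 0%N -> nondecreasing_seq t ->
    mutually_independent
      (fun i : 'I_n => B (t i.+1) - B (t i) : {RV P >-> R}) ;
  (* The second parameter of [normal_prob] is the standard deviation; for
     [s = t] the library's [normal_prob 0 0] is not a Dirac mass, hence the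
     strict inequality. *)
  brownian_gauss : forall s t : R, 0 <= s -> s < t ->
    forall A : set R, measurable A ->
      distribution P (B t - B s) A
      = normal_prob 0 (Num.sqrt (t - s)) A ;
  brownian_cont : {ae P, forall w,
    {within `[0, +oo[, continuous (fun t : R => B t w)}} }.

(* The noise is additive, so the SDE is its integral form, with
   [int_0^t dB_s = B_t] since [B_0 = 0]; the initial conditions are the case
   [t = 0]. All paths of X and Y are continuous, which makes time integrals of
   functions of the paths measurable even when [P] is not complete. *)
Record OU_solution (d : measure_display) (Omega : measurableType d)
    (R : realType) (P : probability Omega R) (B : R -> {RV P >-> R})
    (alpha beta x y : R) (X Y : R -> {RV P >-> R}) : Prop := {
  OU_contX : forall w, {within `[0, +oo[, continuous (fun t : R => X t w)} ;
  OU_contY : forall w, {within `[0, +oo[, continuous (fun t : R => Y t w)} ;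
  OU_eqX : {ae P, forall w, forall t : R, 0 <= t ->
    X t w = x + \int[lebesgue_measure]_(s in `[0, t]) (- alpha * X s w)
            + B t w} ;
  OU_eqY : {ae P, forall w, forall t : R, 0 <= t ->
    Y t w = y + \int[lebesgue_measure]_(s in `[0, t]) (- beta * Y s w)
            + \int[lebesgue_measure]_(s in `[0, t]) X s w} }.

Definition time_average (d : measure_display) (Omega : measurableType d)
    (R : realType) (P : probability Omega R) (f : R -> R)
    (Y : R -> {RV P >-> R}) (T : R) : Omega -> R :=
  fun w => T^-1 * \int[lebesgue_measure]_(t in `[0, T]) f (Y t w).

(* When [alpha = beta] the formula of the second branch is 0 / 0, and it is
   extended by continuity: [delta / (1 - exp (- delta T))] tends to [1 / T] as
   [delta] tends to 0. *)
Definition concentration_exponent (R : realType) (alpha beta T r : R) : R :=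
  let m := Num.min alpha beta in
  let delta := `|alpha - beta| in
  if alpha == beta then
    (- r ^+ 2 * T * m ^+ 2) / (4 * (1 - expR (- (m * T))) ^+ 2 * T ^+ 2)
  else
    (- r ^+ 2 * T * m ^+ 2 * delta ^+ 2)
      / (4 * (1 - expR (- (m * T))) ^+ 2 * (1 - expR (- (delta * T))) ^+ 2).

(* Main.v *)
Require Import Defs.
From HB Require Import structures.
From mathcomp Require Import all_boot all_order all_algebra.
From mathcomp Require Import all_classical all_reals all_analysis.
From mathcomp Require Import measurable_realfun.
From mathcomp Require Import ring lra.

Set Implicit Arguments.
Unset Strict Implicit.
Unset Printing Implicit Defensive.

Import Order.TTheory GRing.Theory Num.Theory.
Import numFieldNormedType.Exports.

Local Open Scope classical_set_scope.
Local Open Scope ring_scope.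

(** The noise enters [Y] linearly: with
    [k u = (exp (- beta u) - exp (- alpha u)) / (alpha - beta)],
    [Y_t] is a deterministic function plus [int_0^t k (t - s) dB_s].  As [f] is
    1-Lipschitz, an increment of [B] at time [s] that changes by [eps] moves the
    time average of [f Y] by at most [eps / T * int_s^T k (t - s) dt], and this is
    at most [eps * C / T] with
    [C = (1 - exp (- m T)) (1 - exp (- delta T)) / (m delta)], where
    [m = min alpha beta] and [delta = |alpha - beta|]; for [alpha = beta] the
    quotient [(1 - exp (- delta T)) / delta] is replaced by its limit [T]
    ([Rintegral_ou_kernel_le], [ou_discrete_average_lipschitz]).  Cut [0, T] into
    [n] pieces: the discretised average is a function of [n] independent centred
    Gaussian increments of variance [T / n], with Lipschitz constant [C / T] in
    each.  The total [n * (C / T)^2 * (T / n) = C^2 / T] does not depend on [n],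
    and it is the [K] of an exponential moment bound
    [E exp (l (F - E F)) <= exp (l^2 K)]; Markov's inequality at
    [l = r / (2 K)] gives [exp (- r^2 / (4 K))], which is the claim.

    The moment bound in one variable ([subgaussian_lipschitz_mgf]) comes from
    symmetrisation: [E exp (l h) * E exp (- l h)] is the integral of
    [cosh (l (h u - h w))] over two independent copies, and [h] may be replaced
    there by the linear function with the same Lipschitz constant, because
    [cosh] is even and increasing in the absolute value.  Jensen's inequality
    bounds the second factor from below.  This loses a factor 2 against the
    optimal Gaussian constant, which is why 4 and not 2 stands in the exponent.
    The bound passes to several variables by integrating out the last increment,
    since what remains is Lipschitz in the other ones ([lipschitz_mgf_indep]).

    The limit in [n] needs a representation of [Y] that makes sense path by
    path.  Integration by parts turns the stochastic integral into
    [int_0^t k' (t - s) B_s ds] ([ou_path_representation]), and replacing [B] by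
    a step path on the grid gives exactly the discretised process
    ([ou_discreteE]).  Convergence is thus almost sure, and Fatou's lemma carries
    the moment bounds over.  The centring constants of the discretised averages
    are not compared to [E F]: they are bounded along a subsequence because [F]
    is finite, and a limit point has to be [E F], since a variable whose
    exponential moments are at most [exp (l^2 K)] for all small [l] of both signs
    has mean 0 ([subgaussian_limit]). *)

(** * Lipschitz functions of one sub-Gaussian variable *)

(** The function [2 cosh] is even and increases with the absolute value; it is
    the tool that replaces a Lipschitz function by a linear one. *)
Lemma cosh_homo (R : realType) (u v : R) : `|u| <= `|v| ->
  expR u + expR (- u) <= expR v + expR (- v).
Proof.
have even (x : R) : expR x + expR (- x) = expR `|x| + expR (- `|x|).
  by case: (ger0P x) => x0; rewrite ?opprK// addrC.
rewrite even (even v); move: `|u| `|v| (normr_ge0 u) => {}u {}v u0 uv.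
have -> : expR v + expR (- v) = expR u + expR (- u)
    + (expR v - expR u) * (1 - expR (- u) * expR (- v)).
  by rewrite !expRN; have := expR_gt0 u; have := expR_gt0 v; move=> ? ?; field;
    rewrite !gt_eqF.
rewrite lerDl mulr_ge0 ?subr_ge0 ?ler_expR//.
by rewrite -expRD -[leRHS]expR0 ler_expR; lra.
Qed.

Lemma normr_le_cosh (R : realType) (x : R) : `|x| <= expR x + expR (- x).
Proof.
have := expR_ge1Dx x; have := expR_ge1Dx (- x).
have := expR_gt0 x; have := expR_gt0 (- x).
by case: (ger0P x) => x0; lra.
Qed.

Section one_dimension.
Context d (T : measurableType d) {R : realType}.

(** [v] is a variance proxy: the bound is an equality for a centred normal [U] of
    variance [v]. *)
Definition subgaussian (nu : probability T R) (U : T -> R) (v : R) :=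
  forall l : R,
  (\int[nu]_z (expR (l * U z))%:E <= (expR (l ^+ 2 * v / 2))%:E)%E.

Variables (nu : probability T R) (U : T -> R) (v : R).
Hypothesis mU : measurable_fun setT U.
Hypothesis nu_sub : subgaussian nu U v.

Lemma subgaussian_integrable_expR (l : R) :
  nu.-integrable setT (EFin \o (fun z => expR (l * U z))).
Proof.
apply/integrableP; split.
  apply/measurable_EFinP; apply: measurableT_comp => //.
  exact: measurable_funM.
under eq_integral do rewrite /= ger0_norm ?expR_ge0//.
by rewrite (le_lt_trans (nu_sub l))// ltry.
Qed.

Variables (h : R -> R) (a : R).
Hypothesis h_lip : forall u w, `|h u - h w| <= a * `|u - w|.

Lemma lipschitz_cst_ge0 : 0 <= a.
Proof. by have := h_lip 1 0; rewrite subr0 normr1 mulr1; exact: le_trans. Qed.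

Lemma lipschitz_continuous : continuous h.
Proof.
have a0 := lipschitz_cst_ge0; have a1 : 0 < a + 1 by lra.
move=> x; apply/cvgrPdist_le => /= e e0; near=> y.
rewrite (le_trans (h_lip _ _))//.
have : `|x - y| <= e / (a + 1).
  by near: y; apply: cvgr_dist_le; [exact: cvg_id|rewrite divr_gt0].
rewrite ler_pdivlMr// => /(le_trans _); apply.
by rewrite mulrC ler_wpM2l// lerDl.
Unshelve. all: by end_near. Qed.

Lemma lipschitz_measurable : measurable_fun setT h.
Proof. exact: continuous_measurable_fun lipschitz_continuous. Qed.

(** Exponential moments dominate the absolute value, hence every function of
    linear growth. *)
Lemma subgaussian_integrable_lipschitz : nu.-integrable setT (EFin \o (h \o U)).
Proof.
have i1 := subgaussian_integrable_expR 1; have i2 := subgaussian_integrable_expR (-1).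
have i0 : nu.-integrable setT (EFin \o cst `|h 0|).
  exact: (finite_measure_integrable_cst nu _ measurableT).
apply: (le_integrable measurableT _ _
  (integrableD measurableT i0 (integrableZl measurableT a (integrableD measurableT i1 i2)))).
  exact/measurable_EFinP/(measurableT_comp lipschitz_measurable).
move=> x _; rewrite /= lee_fin.
rewrite (le_trans _ (ler_norm _))// mul1r mulN1r.
have := h_lip (U x) 0; rewrite subr0 => hx.
have -> : h (U x) = h 0 + (h (U x) - h 0) by ring.
rewrite (le_trans (ler_normD _ _))// lerD2l (le_trans hx)//.
by rewrite ler_wpM2l ?lipschitz_cst_ge0// normr_le_cosh.
Qed.

Lemma subgaussian_integrable_expR_lipschitz (l : R) :
  nu.-integrable setT (EFin \o (fun z => expR (l * h (U z)))).
Proof.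
have i1 := subgaussian_integrable_expR (l * a).
have i2 := subgaussian_integrable_expR (- (l * a)).
apply: (le_integrable measurableT _ _
  (integrableZl measurableT (expR (l * h 0)) (integrableD measurableT i1 i2))).
  apply/measurable_EFinP; apply: measurableT_comp => //.
  by apply: measurable_funM => //; exact: measurableT_comp lipschitz_measurable mU.
move=> x _; rewrite /= lee_fin.
rewrite ger0_norm ?expR_ge0// ger0_norm ?mulr_ge0 ?addr_ge0 ?expR_ge0//.
have -> : l * h (U x) = l * h 0 + l * (h (U x) - h 0) by ring.
rewrite expRD ler_wpM2l ?expR_ge0//.
rewrite (@le_trans _ _ (expR (l * (h (U x) - h 0)) + expR (- (l * (h (U x) - h 0)))))//.
  by rewrite lerDl expR_ge0.
rewrite mulNr; apply: cosh_homo; rewrite -mulrA !normrM ler_wpM2l//.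
by have := h_lip (U x) 0; rewrite subr0 (ger0_norm lipschitz_cst_ge0).
Qed.

(** Symmetrisation.  Write [H s] for the integral of [exp (s h)] and [M s] for
    that of [exp (s U)].  Integrating [cosh_homo] over two independent copies
    gives [H l * H (- l) <= M (l a) * M (- l a)], and [H (- l)] is at least
    [exp (- l m)] by Jensen's inequality, [m] being the mean of [h]. *)
Lemma subgaussian_lipschitz_mgf (l : R) :
  (\int[nu]_z (expR (l * h (U z)))%:E
    <= (expR (l ^+ 2 * (a ^+ 2 * v) + l * \int[nu]_z h (U z)))%:E)%E.
Proof.
have Ih (s : R) := subgaussian_integrable_expR_lipschitz s.
have Ie (s : R) := subgaussian_integrable_expR s.
have IhZ (k s : R) : nu.-integrable setT (EFin \o (fun z => k * expR (s * h (U z)))).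
  exact: integrableZl (Ih s).
have IeZ (k s : R) : nu.-integrable setT (EFin \o (fun z => k * expR (s * U z))).
  exact: integrableZl (Ie s).
pose H (s : R) := \int[nu]_z expR (s * h (U z)).
pose M (s : R) := \int[nu]_z expR (s * U z).
have HE s : (\int[nu]_z (expR (s * h (U z)))%:E = (H s)%:E)%E.
  by rewrite /H /Rintegral fineK//; exact: (integrable_fin_num measurableT (Ih s)).
have ME s : (\int[nu]_z (expR (s * U z))%:E = (M s)%:E)%E.
  by rewrite /M /Rintegral fineK//; exact: (integrable_fin_num measurableT (Ie s)).
have M0 s : 0 <= M s by apply: Rintegral_ge0 => z _; exact: expR_ge0.
have H0 s : 0 <= H s by apply: Rintegral_ge0 => z _; exact: expR_ge0.
have MB s : M s <= expR (s ^+ 2 * v / 2) by rewrite -lee_fin -ME.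
have HD k1 k2 s1 s2 : k1 * H s1 + k2 * H s2
    = \int[nu]_z (k1 * expR (s1 * h (U z)) + k2 * expR (s2 * h (U z))).
  by rewrite RintegralD ?IhZ// !RintegralZl ?Ih.
have MD k1 k2 s1 s2 : k1 * M s1 + k2 * M s2
    = \int[nu]_z (k1 * expR (s1 * U z) + k2 * expR (s2 * U z)).
  by rewrite RintegralD ?IeZ// !RintegralZl ?Ie.
have IhD k1 k2 s1 s2 : nu.-integrable setT
    (EFin \o (fun z => k1 * expR (s1 * h (U z)) + k2 * expR (s2 * h (U z)))).
  exact: integrableD (IhZ _ _) (IhZ _ _).
have IeD k1 k2 s1 s2 : nu.-integrable setT
    (EFin \o (fun z => k1 * expR (s1 * U z) + k2 * expR (s2 * U z))).
  exact: integrableD (IeZ _ _) (IeZ _ _).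
have HNE : H (- l) = \int[nu]_z expR (- l * h (U z)) by [].
(* Opaque from here on: the two-copy inequality is obtained by integrating in one
   copy and then in the other, using only [HD] and [MD]. *)
clearbody H M.
have inner x : H (- l) * expR (l * h (U x)) + H l * expR (- l * h (U x))
    <= M (- (l * a)) * expR (l * a * U x) + M (l * a) * expR (- (l * a) * U x).
  rewrite ![_ * expR _]mulrC HD MD.
  apply: le_Rintegral => //= y _; rewrite -!expRD.
  have -> : - l * h (U x) + l * h (U y) = - (l * h (U x) + - l * h (U y)) by ring.
  have -> : - (l * a) * U x + l * a * U y = - (l * a * U x + - (l * a) * U y) by ring.
  apply: cosh_homo.
  have -> : l * h (U x) + - l * h (U y) = l * (h (U x) - h (U y)) by ring.
  have -> : l * a * U x + - (l * a) * U y = l * (a * (U x - U y)) by ring.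
  by rewrite !normrM (ger0_norm lipschitz_cst_ge0) ler_wpM2l.
have outer : H (- l) * H l + H l * H (- l)
    <= M (- (l * a)) * M (l * a) + M (l * a) * M (- (l * a)).
  by rewrite HD MD; apply: le_Rintegral.
have prodb : H l * H (- l) <= expR (l ^+ 2 * (a ^+ 2 * v)).
  have : M (l * a) * M (- (l * a)) <= expR ((l * a) ^+ 2 * v / 2) * expR ((- (l * a)) ^+ 2 * v / 2).
    by rewrite ler_pM.
  rewrite -expRD; have -> : (l * a) ^+ 2 * v / 2 + (- (l * a)) ^+ 2 * v / 2 = l ^+ 2 * (a ^+ 2 * v).
    by field.
  by move=> ?; lra.
set m := \int[nu]_z h (U z).
have jensen : expR (- (l * m)) <= H (- l).
  (* the tangent line of [exp] at the mean *)
  pose q z := expR (- (l * m)) * (1 + (- l) * (h (U z) - m)).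
  have ihm : nu.-integrable setT (EFin \o (fun z => h (U z) - m)).
    exact: (integrableB measurableT subgaussian_integrable_lipschitz
      (finite_measure_integrable_cst nu m measurableT)).
  have i1 : nu.-integrable setT (EFin \o (fun z => 1 + (- l) * (h (U z) - m))).
    exact: (integrableD measurableT (finite_measure_integrable_cst nu 1 measurableT)
      (integrableZl measurableT (- l) ihm)).
  have iq : nu.-integrable setT (EFin \o q).
    exact: (integrableZl measurableT (expR (- (l * m))) i1).
  have -> : expR (- (l * m)) = \int[nu]_z q z.
    rewrite /q RintegralZl// RintegralD//; last 2 first.
    - exact: (finite_measure_integrable_cst nu _ measurableT).
    - exact: (integrableZl measurableT (- l) ihm).
    rewrite RintegralZl// RintegralB//; last 2 first.
    - exact: subgaussian_integrable_lipschitz.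
    - exact: (finite_measure_integrable_cst nu _ measurableT).
    by rewrite !Rintegral_cst//= -/m probability_setT/=; ring.
  rewrite HNE; apply: le_Rintegral => // z _; rewrite /q.
  have -> : - l * h (U z) = - (l * m) + - l * (h (U z) - m) by ring.
  by rewrite expRD ler_wpM2l ?expR_ge0// expR_ge1Dx.
rewrite HE lee_fin.
have : H l * expR (- (l * m)) <= expR (l ^+ 2 * (a ^+ 2 * v)).
  by rewrite (le_trans _ prodb)// ler_wpM2l.
by rewrite expRD expRN ler_pdivrMr ?expR_gt0.
Qed.

End one_dimension.

(** * The normal law is sub-Gaussian *)

(** The normal density is the Radon-Nikodym derivative up to a null set, so the
    change of variables for the latter applies. *)
Lemma ge0_integral_normal_prob (R : realType) (m s : R) (f : R -> \bar R) :
  (forall x, (0 <= f x)%E) -> measurable_fun (setT : set (measurableTypeR R)) f ->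
  (\int[normal_prob m s]_x f x
    = \int[lebesgue_measure]_x (f x * (normal_pdf m s x)%:E))%E.
Proof.
move=> f0 mf.
have dom := normal_prob_dominates m s.
rewrite -(Radon_Nikodym_SigmaFinite.change_of_variables dom)//.
have mpdf : measurable_fun (setT : set (measurableTypeR R))
    (fun x => (normal_pdf m s x)%:E).
  by apply/measurable_EFinP; exact: measurable_normal_pdf.
have iRN := Radon_Nikodym_SigmaFinite.f_integrable dom.
apply: ae_eq_integral => //.
- by apply: emeasurable_funM => //; exact: measurable_int iRN.
- exact: emeasurable_funM.
- apply: ae_eqe_mul2l; apply: integral_ae_eq => // A _ mA.
  by rewrite -Radon_Nikodym_SigmaFinite.f_integral.
Qed.

(** Completing the square: [exp (l z)] times the centred density is a constant
    times the density of mean [l s^2]. *)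
Lemma normal_mgf (R : realType) (s l : R) : 0 < s ->
  (\int[normal_prob 0 s]_z (expR (l * z))%:E = (expR (l ^+ 2 * s ^+ 2 / 2))%:E)%E.
Proof.
move=> s0; have sn0 : s != 0 by rewrite gt_eqF.
rewrite ge0_integral_normal_prob; last 2 first.
- by move=> x; rewrite lee_fin expR_ge0.
- by apply/measurable_EFinP; apply: measurableT_comp.
under eq_integral => x _.
  rewrite -EFinM [X in X%:E](_ : _ =
    expR (l ^+ 2 * s ^+ 2 / 2) * normal_pdf (l * s ^+ 2) s x); last first.
    rewrite !normal_pdfE// mulrCA [RHS]mulrCA; congr (_ * _).
    rewrite /normal_fun -!expRD; congr expR.
    by field.
  rewrite EFinM.
  over.
rewrite ge0_integralZl//=.
- by rewrite integral_normal_pdf mule1.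
- by apply/measurable_EFinP; exact: measurable_normal_pdf.
- by move=> x _; rewrite lee_fin normal_pdf_ge0.
Qed.

Lemma distribution_normal_subgaussian (R : realType) d (T : measurableType d)
    (P : probability T R) (Z : {RV P >-> R}) (s : R) : 0 < s ->
  (forall A : set R, measurable A -> distribution P Z A = normal_prob 0 s A) ->
  subgaussian P Z (s ^+ 2).
Proof.
move=> s0 Zs l.
(* [normal_prob] is a measure on [measurableTypeR R] while [Z] takes its values in
   [R]: the same Borel sets under two structures, exchanged by the identity. *)
pose i : R -> measurableTypeR R := idfun.
have mi : measurable_fun setT i by move=> _ A mA; rewrite setTI.
have me : measurable_fun (setT : set (measurableTypeR R)) (fun z => (expR (l * z))%:E).
  by apply/measurable_EFinP; apply: measurableT_comp.
have mj : measurable_fun setT (i \o Z) by exact: measurableT_comp.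
pose jm := isMeasurableFun.Build _ _ _ _ (i \o Z) mj.
pose j : {mfun T >-> measurableTypeR R} := HB.pack (i \o Z) jm.
rewrite -normal_mgf//.
have -> : (\int[normal_prob 0 s]_z (expR (l * z))%:E =
    \int[distribution P j]_z (expR (l * z))%:E)%E.
  by apply: eq_measure_integral => A mA _; exact/esym/(Zs A mA).
by rewrite ge0_integral_distribution// => x; rewrite lee_fin expR_ge0.
Qed.

(** * Integrating out a variable independent of the past *)

(** Positive and negative parts are treated separately, as no integrability in
    the product space is at hand: where the integral diverges, [fine] still gives
    a measurable function. *)
Lemma measurable_Rintegral_param (R : realType) d1 d2 (S : measurableType d1)
    (T : measurableType d2) (m : {sigma_finite_measure set T -> \bar R})
    (D : set T) (f : S * T -> R) : measurable D -> measurable_fun setT f ->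
  measurable_fun setT (fun s => \int[m]_(t in D) f (s, t)).
Proof.
move=> mD mf.
pose g (p : S * T) := (f p * \1_D p.2)%:E.
have mg : measurable_fun setT g.
  apply/measurable_EFinP; apply: measurable_funM => //.
  by apply: measurableT_comp.
have -> : (fun s => \int[m]_(t in D) f (s, t))
    = fine \o (fun s => \int[m]_t (g^\+ (s, t)) - \int[m]_t (g^\- (s, t)))%E.
  apply/funext => s /=; rewrite /Rintegral integral_mkcond integralE.
  congr (fine (_ - _)%E); apply: eq_integral => t _; rewrite ?funeposE ?funenegE /g /= patchE indicE.
    by case: ifP => _; rewrite ?mulr1 ?mulr0.
  by case: ifP => _; rewrite ?mulr1 ?mulr0.
apply: measurableT_comp => //.
have mG (k : S * T -> \bar R) : measurable_fun setT k -> (forall p, 0 <= k p)%E ->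
    measurable_fun setT (fun s => \int[m]_t k (s, t))%E.
  by move=> mk k0; exact: (@measurable_fun_fubini_tonelli_F _ _ _ _ _ m k).
apply: emeasurable_funB; apply: mG => //.
  exact: measurable_funepos.
exact: measurable_funeneg.
Qed.

Section past.
Context {R : realType} d (Omega : measurableType d) (P : probability Omega R).
Variable Z : nat -> {RV P >-> R}.
Hypothesis Zindep : forall n, mutually_independent (fun i : 'I_n => Z i).

Definition past_cylinder n : set (set Omega) :=
  [set B | exists A : nat -> set R, (forall i, measurable (A i)) /\
    B = \bigcap_(i : 'I_n) (Z i @^-1` A i)].

(** The sample space under the sigma-algebra generated by the first [n]
    variables: independence of [Z n] from the whole family becomes independence of
    two maps, the identity into [past n] and [Z n] itself. *)
Definition past n := g_sigma_algebraType (past_cylinder n).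

Lemma past_cylinder_measurable n : past_cylinder n `<=` measurable.
Proof.
move=> _ [A [mA ->]]; apply: fin_bigcap_measurable => [|i _]; first exact: finite_finset.
exact: measurable_funPTI.
Qed.

Lemma past_cylinder_setI n : setI_closed (past_cylinder n).
Proof.
move=> _ _ [A [mA ->]] [A' [mA' ->]].
exists (fun i => A i `&` A' i); split; first by move=> i; exact: measurableI.
by rewrite -bigcapI; apply: eq_bigcapr => i _; rewrite preimage_setI.
Qed.

Lemma past_cylinder_indep n B (C : set R) : past_cylinder n B -> measurable C ->
  P (B `&` Z n @^-1` C) = (P B * P (Z n @^-1` C))%E.
Proof.
move=> [A [mA ->]] mC.
pose A' i := if (i < n)%N then A i else C.
have mA' i : measurable (A' i) by rewrite /A'; case: ifP.
have := @Zindep n.+1 (fun i => A' i) (fun i => mA' i).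
have A'n : A' n = C by rewrite /A' ltnn.
have A'lt (i : 'I_n) : A' i = A i by rewrite /A' ltn_ord.
rewrite big_ord_recr /= A'n.
under eq_bigr => i _ do rewrite A'lt.
rewrite -(@Zindep n (fun i => A i)) => [<-|//].
congr (P _); apply/seteqP; split => [w [wA wC] i _|w wA].
  rewrite /A' /=; case: ifPn => [iltn|].
    exact: (wA (Ordinal iltn)).
  rewrite -leqNgt => ni; have -> // : i = ord_max.
  by apply/val_inj/eqP; rewrite eqn_leq /= ni -ltnS ltn_ord.
split=> [i _|].
  by have := wA (widen_ord (leqnSn n) i) I; rewrite /A' /= ltn_ord.
by have := wA ord_max I; rewrite /A' /= ltnn.
Qed.

(** For fixed [C], both sides are finite measures in [B] that agree on the
    cylinders, which are stable under intersection. *)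
Lemma past_indep n B (C : set R) : <<s past_cylinder n >> B -> measurable C ->
  P (B `&` Z n @^-1` C) = (P B * P (Z n @^-1` C))%E.
Proof.
move=> sB mC.
have mZC : measurable (Z n @^-1` C) by exact: measurable_funPTI.
have r0 : 0 <= fine (P (Z n @^-1` C)) by exact: fine_ge0.
pose m2 := mscale (NngNum r0) P.
have E D : m2 D = (P D * P (Z n @^-1` C))%E.
  by rewrite /m2 /mscale /= fineK ?fin_num_measure// muleC.
rewrite -E -[LHS]/(mrestr P mZC B).
have HE : [set X | past_cylinder n X /\ X `<=` setT] = past_cylinder n.
  by apply/seteqP; split => [X []|X].
apply: (@g_sigma_algebra_measure_unique_trace _ _ _ (past_cylinder n) setT measurableT) => //=;
  rewrite ?HE//.
- exact: past_cylinder_measurable.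
- exact: past_cylinder_setI.
- by rewrite /mrestr setTI -[RHS]/(m2 setT) E probability_setT mul1e.
- by move=> A [GA _]; rewrite /mrestr past_cylinder_indep//; exact/esym/E.
- by rewrite /mrestr setTI (le_lt_trans (probability_le1 P mZC))// ltry.
Qed.

Lemma measurable_past n i : (i < n)%N -> measurable_fun (setT : set (past n)) (Z i : past n -> R).
Proof.
move=> iltn _ C mC; rewrite setTI; apply: sub_sigma_algebra.
exists (fun j => if j == i then C else setT); split.
  by move=> j; case: ifP.
apply/seteqP; split => [w wC j _ /=|w /(_ (Ordinal iltn) I) /=]; last by rewrite eqxx.
by case: ifP => // /eqP ->.
Qed.

Let idp n : Omega -> past n := idfun.

Lemma measurable_idp n : measurable_fun setT (idp n).
Proof.
move=> _ B sB; rewrite setTI.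
exact: (smallest_sub (@sigma_algebra_measurable _ Omega) (@past_cylinder_measurable n) sB).
Qed.

HB.instance Definition _ n := isMeasurableFun.Build _ _ _ _ (idp n) (@measurable_idp n).

(** By [past_indep], the joint law of the past and of [Z n] is the product of
    the two laws; Tonelli's theorem then separates the integrals. *)
Lemma integral_past n (h : past n * R -> \bar R) : measurable_fun setT h ->
  (forall p, 0 <= h p)%E ->
  (\int[P]_w h (w, Z n w) = \int[P]_w \int[distribution P (Z n)]_u h (w, u))%E.
Proof.
move=> mh h0.
pose J (w : Omega) : past n * R := (idp n w, Z n w).
have mJ : measurable_fun setT J.
  by apply: measurable_fun_pair.
pose jm := isMeasurableFun.Build _ _ _ _ J mJ.
pose Jm : {mfun Omega >-> (past n * R)%type} := HB.pack J jm.
have -> : (\int[P]_w h (w, Z n w) = \int[distribution P Jm]_p h p)%E.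
  by rewrite ge0_integral_distribution.
have -> : (\int[distribution P Jm]_p h p
    = \int[distribution P (idp n) \x distribution P (Z n)]_p h p)%E.
  apply: eq_measure_integral => A mA _; apply/esym.
  apply: product_measure_unique => // B C mB mC.
  exact: past_indep.
rewrite fubini_tonelli1// ge0_integral_distribution//.
- exact: measurable_fun_fubini_tonelli_F.
- by move=> w; apply: integral_ge0.
Qed.

End past.

(** * Lipschitz functions of independent variables *)

(** Measurability for functions of a sequence, tested on every measurable family
    of coordinates.  Quantifying over the source space makes the notion stable
    under integration in one coordinate ([cyl_measurable_integrate]). *)
Definition cyl_measurable (R : realType) (g : (nat -> R) -> R) :=
  forall d (S : measurableType d) (Z : nat -> S -> R),
    (forall i, measurable_fun setT (Z i)) ->
    measurable_fun setT (fun s => g (fun i => Z i s)).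

(** Vectors are represented by sequences; the coordinates from [n.+1] on are set
    to 0, so that only the first [n] coordinates of [z] matter. *)
Definition coord_set (R : realType) (n : nat) (z : nat -> R) (u : R) : nat -> R :=
  fun i => if (i < n)%N then z i else if i == n then u else 0.

Lemma measurable_coord_set (R : realType) d (S : measurableType d) n
    (Z : nat -> S -> R) i :
  (forall j, (j < n)%N -> measurable_fun setT (Z j)) ->
  measurable_fun setT (fun p : S * R => coord_set n (fun j => Z j p.1) p.2 i).
Proof.
move=> mZ; rewrite /coord_set; case iltn : (i < n)%N.
  exact: (measurableT_comp (mZ i iltn) measurable_fst).
by case: (i == n); [exact: measurable_snd|exact: measurable_cst].
Qed.

Section induction.
Context {R : realType} d (Omega : measurableType d) (P : probability Omega R).
Variables (Z : nat -> {RV P >-> R}) (a v : R).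
Hypothesis Zindep : forall n, mutually_independent (fun i : 'I_n => Z i).
Hypothesis Zsub : forall i, subgaussian P (Z i) v.

Let lip n (g : (nat -> R) -> R) :=
  forall z z', `|g z - g z'| <= a * \sum_(i < n) `|z i - z' i|.

Lemma coord_set_sum n (z z' : nat -> R) u u' :
  \sum_(i < n.+1) `|coord_set n z u i - coord_set n z' u' i|
  = \sum_(i < n) `|z i - z' i| + `|u - u'|.
Proof.
rewrite big_ord_recr /= /coord_set ltnn eqxx; congr (_ + _).
by apply: eq_bigr => i _; rewrite /= ltn_ord.
Qed.

Lemma integral_coord_set n g (k : R -> R) : cyl_measurable g -> lip n.+1 g ->
  measurable_fun setT k -> (forall x, 0 <= k x) ->
  (\int[P]_w (k (g (fun i => Z i w)))%:E =
   \int[P]_w \int[distribution P (Z n)]_u (k (g (coord_set n (fun i => Z i w) u)))%:E)%E.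
Proof.
move=> mg lg mk k0.
pose h (p : past Z n * R) := (k (g (coord_set n (fun i => Z i p.1) p.2)))%:E.
have -> : (\int[P]_w (k (g (fun i => Z i w)))%:E = \int[P]_w h (w, Z n w))%E.
  apply: eq_integral => w _; congr (k _)%:E; apply/eqP.
  rewrite -subr_eq0 -normr_le0 (le_trans (lg _ _))//.
  rewrite big1 ?mulr0// => i _; rewrite /coord_set /=.
  case: ltnP => [|ni]; first by rewrite subrr normr0.
  have -> : i = n :> nat by apply/eqP; rewrite eqn_leq ni -ltnS ltn_ord.
  by rewrite eqxx subrr normr0.
rewrite (integral_past Zindep)//; last by move=> p; rewrite lee_fin.
apply/measurable_EFinP; apply: (measurableT_comp mk).
apply: (mg _ _ (fun i (p : past Z n * R) => coord_set n (fun i => Z i p.1) p.2 i)) => i.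
apply: (@measurable_coord_set _ _ (past Z n) n (fun j => Z j : past Z n -> R)) => j.
exact: measurable_past.
Qed.

Lemma measurable_integral_coord_set n g (k : R -> R) : cyl_measurable g ->
  measurable_fun setT k -> (forall x, 0 <= k x) ->
  measurable_fun setT (fun w =>
    \int[distribution P (Z n)]_u (k (g (coord_set n (fun i => Z i w) u)))%:E)%E.
Proof.
move=> mg mk k0.
pose h (p : Omega * R) := (k (g (coord_set n (fun i => Z i p.1) p.2)))%:E.
apply: (@measurable_fun_fubini_tonelli_F _ _ _ _ _ (distribution P (Z n)) h).
  apply/measurable_EFinP; apply: (measurableT_comp mk).
  apply: (mg _ _ (fun i (p : Omega * R) => coord_set n (fun i => Z i p.1) p.2 i)) => i.
  apply: (@measurable_coord_set _ _ Omega n (fun j => Z j)) => j _.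
  exact: measurable_funPT.
by move=> p; rewrite lee_fin.
Qed.

Lemma cyl_measurable_integrate n g : cyl_measurable g ->
  cyl_measurable (fun z => \int[distribution P (Z n)]_u g (coord_set n z u)).
Proof.
move=> mg e S Z' mZ'.
apply: (measurable_Rintegral_param (distribution P (Z n))
  (f := fun p : S * R => g (coord_set n (fun i => Z' i p.1) p.2))) => //.
apply: (mg _ _ (fun i (p : S * R) => coord_set n (fun i => Z' i p.1) p.2 i)) => i.
by apply: (@measurable_coord_set _ _ S n Z') => j _.
Qed.

(** Induction on the number of variables.  For frozen [z], the function
    [u |-> g (coord_set n z u)] is [a]-Lipschitz and the one-variable bound
    applies; its mean [g' z] is again [a]-Lipschitz in each of the remaining
    variables and keeps the mean of [g], which is the centre [c]. *)
Lemma lipschitz_mgf_indep n g : cyl_measurable g -> lip n g ->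
  exists c, forall l : R,
    (\int[P]_w (expR (l * (g (fun i => Z i w) - c)))%:E
      <= (expR (l ^+ 2 * (n%:R * (a ^+ 2 * v))))%:E)%E.
Proof.
elim: n g => [|n IHn] g mg lg.
  exists (g (fun=> 0)) => l; under eq_integral => w _.
    have -> : g (fun i => Z i w) = g (fun=> 0).
      apply/eqP; rewrite -subr_eq0 -normr_le0 (le_trans (lg _ _))//.
      by rewrite big_ord0 mulr0.
    rewrite subrr mulr0; over.
  by rewrite integral_cst//= probability_setT mule1 mul0r mulr0.
pose nu := distribution P (Z n).
have id_sub : subgaussian nu idfun v.
  move=> l; rewrite (le_trans _ (Zsub n l))//.
  rewrite ge0_integral_distribution//=.
  by apply/measurable_EFinP; apply: measurableT_comp.
have mid : measurable_fun setT (@idfun R) by exact: measurable_id.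
have lgu z u w : `|g (coord_set n z u) - g (coord_set n z w)| <= a * `|u - w|.
  rewrite (le_trans (lg _ _))// coord_set_sum big1 ?add0r//.
  by move=> i _; rewrite subrr normr0.
pose g' z := \int[nu]_u g (coord_set n z u).
have ig z : nu.-integrable setT (EFin \o (fun u => g (coord_set n z u))).
  exact: (subgaussian_integrable_lipschitz mid id_sub (lgu z)).
have lg' : lip n g'.
  move=> z z'; rewrite /g' -RintegralB//.
  have ib : nu.-integrable setT
      (EFin \o (fun u => g (coord_set n z u) - g (coord_set n z' u))).
    exact: integrableB (ig z) (ig z').
  rewrite (le_trans (le_normr_Rintegral _ _))//.
  have ic : nu.-integrable setT (EFin \o cst (a * \sum_(i < n) `|z i - z' i|)).
    exact: (finite_measure_integrable_cst nu _ measurableT).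
  rewrite -[leRHS]mulr1 -[X in _ * X](_ : fine (nu setT) = 1); last first.
    by rewrite /nu probability_setT.
  rewrite -Rintegral_cst//; apply: le_Rintegral => //.
    exact: integrable_norm ib.
  by move=> u _; rewrite (le_trans (lg _ _))// coord_set_sum subrr normr0 addr0.
have [c gc] := IHn g' (cyl_measurable_integrate n mg) lg'.
exists c => l.
have mk : measurable_fun setT (fun x : R => expR (l * (x - c))).
  apply: measurableT_comp => //; apply: measurable_funM => //.
  exact: measurable_funB.
rewrite (integral_coord_set mg lg mk)//.
have mg'Z : measurable_fun setT (fun w => g' (fun i => Z i w)).
  by apply: (cyl_measurable_integrate n mg (Z := fun i => Z i)) => i; exact: measurable_funPT.
apply: (@le_trans _ _ (\int[P]_w ((expR (l ^+ 2 * (a ^+ 2 * v)))%:E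
    * (expR (l * (g' (fun i => Z i w) - c)))%:E))%E).
  apply: ge0_le_integral => //.
  - by move=> w _; apply: integral_ge0 => u _; rewrite lee_fin expR_ge0.
  - exact: (measurable_integral_coord_set n mg mk).
  - apply: emeasurable_funM; first exact: measurable_cst.
    by apply/measurable_EFinP; exact: (measurableT_comp mk).
  - move=> w _; set z := fun i => Z i w.
    have hlip u u' : `|(g (coord_set n z u) - c) - (g (coord_set n z u') - c)| <= a * `|u - u'|.
      have -> : (g (coord_set n z u) - c) - (g (coord_set n z u') - c)
        = g (coord_set n z u) - g (coord_set n z u') by ring.
      exact: lgu.
    apply: (le_trans (subgaussian_lipschitz_mgf mid id_sub hlip l)).
    rewrite -EFinM -expRD lee_fin ler_expR lerD2l RintegralB//.
      rewrite Rintegral_cst// [X in c * X](_ : _ = 1) ?mulr1//.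
      exact: (congr1 fine (probability_setT (distribution P (Z n)))).
    exact: (finite_measure_integrable_cst nu c measurableT).
rewrite ge0_integralZl//.
- apply: (le_trans (lee_wpmul2l _ (gc l))); first by rewrite lee_fin expR_ge0.
  by rewrite -EFinM -expRD lee_fin ler_expR -mulrDr -natr1 mulrDl mul1r addrC.
- by apply/measurable_EFinP; exact: (measurableT_comp mk).
Qed.

End induction.

(** * Passing to the limit in exponential moments *)

(** Fatou's lemma, where the lower limit is [g] up to a null set. *)
Lemma integral_limit_le (R : realType) d (T : measurableType d)
    (P : {measure set T -> \bar R}) (G : nat -> T -> \bar R) (g : T -> \bar R)
    (C : \bar R) :
  (forall n, measurable_fun setT (G n)) -> (forall n x, (0 <= G n x)%E) ->
  measurable_fun setT g -> (forall x, (0 <= g x)%E) ->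
  {ae P, forall x, G ^~ x @ \oo --> g x} ->
  (forall n, (\int[P]_x G n x <= C)%E) -> (\int[P]_x g x <= C)%E.
Proof.
move=> mG G0 mg g0 Gg GC.
have -> : (\int[P]_x g x = \int[P]_x limn_einf (G^~ x))%E.
  apply: ge0_ae_eq_integral => //.
  - apply: measurableT_comp => //; apply: measurable_fun_limn_esup => n.
    exact: measurableT_comp.
  - move=> x _; rewrite limn_einf_lim; apply: lime_ge; first exact: is_cvg_einfs.
    by apply: nearW => n; apply: le_ereal_inf_tmp => _ [m _ <-].
  - by apply: filterS Gg => x /cvg_limn_einf_sup[-> _] _.
apply: (le_trans (fatou P measurableT mG (fun n x _ => G0 n x))).
rewrite limn_einf_lim; apply: lime_le; first exact: is_cvg_einfs.
apply: nearW => n; apply: le_trans (GC n).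
by apply: ereal_inf_lbound; exists n => /=.
Qed.

Lemma cvg_subseq_ge (T : topologicalType) (u : nat -> T) (l : T) (s : nat -> nat) :
  (forall n, (n <= s n)%N) -> u @ \oo --> l -> (u \o s) @ \oo --> l.
Proof.
move=> sn ul; apply: cvg_comp ul.
by move=> A [N _ NA]; exists N => // n /= Nn; apply: NA => /=; exact: leq_trans (sn n).
Qed.

(** The right-hand side is of order [l^2] near 0, so letting [l] tend to 0 from
    each side leaves no room for a linear term. *)
Lemma mean_zero_of_mgf (R : realType) (m K : R) : 0 <= K ->
  (forall l, l * m <= expR (l ^+ 2 * K) - 1) -> m = 0.
Proof.
move=> K0.
suff pos (x : R) : (forall l, l * x <= expR (l ^+ 2 * K) - 1) -> x <= 0.
  move=> mK; apply/eqP; rewrite eq_le pos//=.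
  rewrite -oppr_le0; apply: pos => l.
  by rewrite mulrN -mulNr -(sqrrN l).
move=> xK; rewrite leNgt; apply/negP => x0.
(* Small enough for both [l^2 K <= 1/2], where [exp y - 1 <= 2 y], and
   [2 l K < x]. *)
pose l := x / ((2 * K + 1) * (x + 1)).
have D0 : 0 < (2 * K + 1) * (x + 1) by rewrite mulr_gt0; lra.
have l0 : 0 < l by rewrite divr_gt0.
have lK : l * K <= 1 / 2 by rewrite /l mulrAC ler_pdivrMr//; nra.
have l1 : l <= 1 by rewrite /l ler_pdivrMr//; nra.
have lKx : 2 * (l * K) < x.
  have <- : l * ((2 * K + 1) * (x + 1)) = x by rewrite divfK ?gt_eqF.
  by rewrite mulrCA ltr_pM2l//; nra.
set y := l ^+ 2 * K.
have y2 : y <= 1 / 2 by rewrite /y expr2; nra.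
have y0 : 0 <= y by rewrite /y mulr_ge0 ?sqr_ge0.
have ey : expR y - 1 <= 2 * y.
  have := expR_ge1Dx (- y); rewrite expRN => h.
  have e0 := expR_gt0 y.
  have : (1 - y) * expR y <= 1 by rewrite -ler_pdivlMr// div1r.
  nra.
have := xK l; rewrite -/y => h.
have : l * x <= l * (2 * (l * K)) by rewrite (le_trans h)// (le_trans ey)// /y expr2; lra.
by rewrite ler_pM2l//; lra.
Qed.

Section subgaussian_limit.
Context {R : realType} d (T : measurableType d) (P : probability T R).
Variables (F_ : nat -> T -> R) (F : T -> R) (K : R).
Hypothesis mF_ : forall n, measurable_fun setT (F_ n).
Hypothesis mF : measurable_fun setT F.
Hypothesis F_F : {ae P, forall w, F_ ^~ w @ \oo --> F w}.
Hypothesis K0 : 0 <= K.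
Hypothesis F_mgf : forall n, exists c, forall l : R,
  (\int[P]_w (expR (l * (F_ n w - c)))%:E <= (expR (l ^+ 2 * K))%:E)%E.

Let m_exp (G : T -> R) (l c : R) : measurable_fun setT G ->
  measurable_fun setT (fun w => (expR (l * (G w - c)))%:E).
Proof.
move=> mG; apply/measurable_EFinP; apply: measurableT_comp => //.
by apply: measurable_funM => //; exact: measurable_funB.
Qed.

(** If the centres escaped to infinity, then so would [|F_ n w - c n|] for almost
    every [w], as [F_ n w] converges to a finite limit; by Fatou's lemma the
    exponential moments at [l = 1] and [l = -1] could not both stay bounded. *)
Lemma centers_frequently_bounded (c : nat -> R) :
  (forall n l, (\int[P]_w (expR (l * (F_ n w - c n)))%:E <= (expR (l ^+ 2 * K))%:E)%E) ->
  exists M, forall N, exists n, (N <= n)%N /\ `|c n| <= M.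
Proof.
move=> cK; apply: contrapT => noM.
have cy M : exists N, forall n, (N <= n)%N -> M < `|c n|.
  apply: contrapT => noN; apply: noM; exists M => N.
  apply: contrapT => nn; apply: noN; exists N => n Nn.
  by rewrite ltNge; apply/negP => cM; apply: nn; exists n.
pose G n w := ((expR (1 * (F_ n w - c n)))%:E + (expR (- 1 * (F_ n w - c n)))%:E)%E.
have : (\int[P]_w (cst +oo w) <= (expR K)%:E + (expR K)%:E)%E.
  apply: (@integral_limit_le _ _ _ _ G) => //.
  - by move=> n; apply: emeasurable_funD; exact: m_exp.
  - by move=> n w; rewrite adde_ge0// lee_fin expR_ge0.
  - by move=> w /=; rewrite leey.
  - apply: filterS F_F => w Fw; apply/cvgeyPge => A.
    have [N1 _ hN1] : \forall n \near \oo, `|F w - F_ n w| <= 1.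
      by move/cvgrPdist_le : Fw => /(_ 1 ltr01).
    have [N2 hN2] := cy (A + 1 + `|F w|).
    exists (maxn N1 N2) => // n /=; rewrite geq_max => /andP[n1 n2].
    rewrite /G -EFinD lee_fin mul1r mulN1r.
    apply: (le_trans _ (normr_le_cosh _)).
    have := hN1 n n1; have := hN2 n n2 => /= h1 h2.
    have := ler_normD (F w - F_ n w) (F_ n w - c n).
    have := ler_normD (F w) (- (F w - c n)).
    have -> : F w - F_ n w + (F_ n w - c n) = F w - c n by ring.
    have -> : F w + - (F w - c n) = c n by ring.
    by rewrite normrN; lra.
  - move=> n; rewrite ge0_integralD//.
    + apply: leeD; [have := cK n 1|have := cK n (-1)]; by rewrite ?sqrrN expr1n mul1r.
    + exact: m_exp.
    + exact: m_exp.
have Poo : (+oo * P setT = +oo)%E by rewrite probability_setT mule1.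
by rewrite integral_cst// Poo -EFinD leye_eq.
Qed.

(** Along a subsequence the centres converge, and Fatou's lemma applies. *)
Lemma subgaussian_limit_center : exists c, forall l : R,
  (\int[P]_w (expR (l * (F w - c)))%:E <= (expR (l ^+ 2 * K))%:E)%E.
Proof.
have [c cK] := choice F_mgf.
have [M cM] := centers_frequently_bounded cK.
have [s sP] := choice cM.
have [|t tincr ct] := @bolzano_weierstrass R (c \o s).
  exists M; split; first exact: num_real.
  by move=> x Mx n _ /=; rewrite (le_trans (sP n).2)// ltW.
have tn n : (n <= t n)%N.
  elim: n => // n IH; rewrite (leq_ltn_trans IH)//.
  exact: (increasing_seqP t).2.
exists (lim ((c \o s) \o t @ \oo)) => l.
apply: (@integral_limit_le _ _ _ _
  (fun n w => (expR (l * (F_ (s (t n)) w - c (s (t n)))))%:E)) => //.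
- by move=> n; exact: m_exp.
- exact: m_exp.
- apply: filterS F_F => w Fw.
  apply: cvg_EFin; first exact: nearW.
  apply: (cvg_comp _ expR); last exact: continuous_expR.
  apply: cvgM; first exact: cvg_cst.
  apply: (@cvgB _ R^o) => //.
  apply: (@cvg_subseq_ge _ (fun n => F_ n w) _ (s \o t)) => // n.
  exact: leq_trans (tn n) (sP (t n)).1.
Qed.

(** The centre found in the limit is the expectation: from [1 + x <= exp x] the
    mean of [F - c] satisfies the hypothesis of [mean_zero_of_mgf]. *)
Lemma subgaussian_limit : P.-integrable setT (EFin \o F) /\ forall l : R,
  (\int[P]_w (expR (l * (F w - \int[P]_x F x)))%:E <= (expR (l ^+ 2 * K))%:E)%E.
Proof.
have [c cK] := subgaussian_limit_center.
have iexp l : P.-integrable setT (EFin \o (fun w => expR (l * (F w - c)))).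
  apply/integrableP; split; first exact: m_exp.
  under eq_integral do rewrite /= ger0_norm ?expR_ge0//.
  by rewrite (le_lt_trans (cK l))// ltry.
have ic : P.-integrable setT (EFin \o cst c).
  exact: (finite_measure_integrable_cst P c measurableT).
have i1 : P.-integrable setT (EFin \o cst 1).
  exact: (finite_measure_integrable_cst P 1 measurableT).
have iFc : P.-integrable setT (EFin \o (fun w => F w - c)).
  apply: (le_integrable measurableT _ _ (integrableD measurableT (iexp 1) (iexp (-1)))).
    by apply/measurable_EFinP; exact: measurable_funB.
  move=> w _; rewrite /= lee_fin (le_trans _ (ler_norm _))// mul1r mulN1r.
  exact: normr_le_cosh.
have iF : P.-integrable setT (EFin \o F).
  have := integrableD measurableT iFc ic.
  by apply: eq_integrable => // w _ /=; rewrite -EFinD subrK.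
have P1 : fine (P setT) = 1 by rewrite probability_setT.
suff -> : \int[P]_x F x = c by [].
have : \int[P]_x (F x - c) = 0.
  apply: (mean_zero_of_mgf K0) => l; rewrite -RintegralZl//.
  have ilFc : P.-integrable setT (EFin \o (fun w => l * (F w - c))).
    exact: integrableZl iFc.
  have i1l : P.-integrable setT (EFin \o (fun w => 1 + l * (F w - c))).
    exact: integrableD i1 ilFc.
  have : \int[P]_w (1 + l * (F w - c)) <= \int[P]_w expR (l * (F w - c)).
    by apply: le_Rintegral => // w _; exact: expR_ge1Dx.
  rewrite RintegralD// Rintegral_cst// P1 mulr1.
  have : \int[P]_w expR (l * (F w - c)) <= expR (l ^+ 2 * K).
    rewrite -lee_fin /Rintegral fineK//.
    exact: (integrable_fin_num measurableT (iexp l)).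
  lra.
by rewrite RintegralB// Rintegral_cst// P1 mulr1 => /eqP; rewrite subr_eq0 => /eqP.
Qed.

End subgaussian_limit.

(** Chernoff's bound at the minimiser [l = r / (2 K)] of [l^2 K - l r]. *)
Lemma subgaussian_tail (R : realType) d (T : measurableType d) (P : probability T R)
    (F : T -> R) (c K r : R) : measurable_fun setT F -> 0 < K -> 0 < r ->
  (forall l : R,
    (\int[P]_w (expR (l * (F w - c)))%:E <= (expR (l ^+ 2 * K))%:E)%E) ->
  (P [set w | r <= F w - c]%R <= (expR (- (r ^+ 2 / (4 * K))))%:E)%E.
Proof.
move=> mF K0 r0 FK.
have mX : measurable_fun setT (fun w => F w - c) by exact: measurable_funB.
pose jm := isMeasurableFun.Build _ _ _ _ (fun w => F w - c) mX.
pose X : {RV P >-> R} := HB.pack (fun w => F w - c) jm.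
pose l := r / (2 * K).
have l0 : 0 < l by rewrite divr_gt0// mulr_gt0.
apply: (le_trans (chernoff X r l0)).
have -> : expR (- (r ^+ 2 / (4 * K))) = expR (l ^+ 2 * K) * expR (- (l * r)).
  by rewrite -expRD; congr expR; rewrite /l; field; rewrite gt_eqF.
rewrite EFinM; apply: lee_wpmul2r; first by rewrite lee_fin expR_ge0.
rewrite /mmt_gen_fun unlock; apply: le_trans (FK l).
by under eq_integral => w _ do rewrite /= mulrC.
Qed.

(** * Uniform approximation of continuous paths by step paths *)

Section step_path.
Context {R : realType}.
Implicit Types (B : R -> R) (T s : R).

(** The grid has [n.+1] cells, so that no division by 0 has to be excluded. *)
Definition grid T n (i : nat) : R := i%:R * (T / n.+1%:R).

(** On the cell starting at [grid T n i] the path takes the value of [B] at the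
    right end of the cell.  In this form the increments appear as coefficients,
    so that linear functionals of the step path are explicit in them. *)
Definition step_path T n B s : R := B 0 +
  \sum_(i < n.+1) (B (grid T n i.+1) - B (grid T n i)) * \1_(`[grid T n i, +oo[) s.

Lemma grid0 T n : grid T n 0 = 0. Proof. by rewrite /grid mul0r. Qed.

Lemma gridT T n : grid T n n.+1 = T.
Proof. by rewrite /grid mulrC divfK. Qed.

Lemma grid_nondecreasing T n : 0 <= T -> nondecreasing_seq (grid T n).
Proof. by move=> T0 i j ij; rewrite /grid ler_wpM2r ?divr_ge0 ?ler_nat. Qed.

Lemma gridS T n i : grid T n i.+1 - grid T n i = T / n.+1%:R.
Proof. by rewrite /grid -mulrBl -natr1 addrAC subrr add0r mul1r. Qed.

Lemma grid_ge0 T n i : 0 <= T -> 0 <= grid T n i.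
Proof. by move=> T0; rewrite mulr_ge0 ?divr_ge0. Qed.

(** The sum telescopes up to the cell [j] that contains [s]; the last cell is
    taken for [s = T], whence the minimum with [n]. *)
Lemma step_pathE T n B s : 0 < T -> 0 <= s <= T ->
  exists u, [/\ 0 <= u <= T, `|s - u| <= T / n.+1%:R & step_path T n B s = B u].
Proof.
move=> T0 /andP[s0 sT].
pose h := T / n.+1%:R.
have h0 : 0 < h by rewrite divr_gt0.
pose j := minn (Num.truncn (s / h)) n.
have jn : (j <= n)%N by exact: geq_minr.
have sh0 : 0 <= s / h by rewrite divr_ge0// ltW.
have ij (i : nat) : (i < n.+1)%N -> (grid T n i <= s) = (i < j.+1)%N.
  rewrite ltnS => iltn; rewrite /grid -/h -ler_pdivlMr// -truncn_ge_nat//.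
  by rewrite ltnS /j leq_min iltn andbT.
have sj : grid T n j <= s by rewrite ij.
have jT : grid T n j.+1 <= T by rewrite -[leRHS](gridT T n); apply: grid_nondecreasing; rewrite ?ltW.
exists (grid T n j.+1); split.
- by rewrite jT grid_ge0// ltW.
- have := gridS T n j; rewrite -/h => gS.
  suff : s <= grid T n j.+1 by move=> ?; rewrite ler_norml; lra.
  have [jlt|jge] := ltnP j n.
    by rewrite leNgt; apply/negP => /ltW; rewrite ij// ltnn.
  by have -> : j = n by [apply/eqP; rewrite eqn_leq jn jge]; rewrite gridT.
rewrite /step_path -(big_mkord xpredT (fun i : nat =>
  (B (grid T n i.+1) - B (grid T n i)) * \1_(`[grid T n i, +oo[) s)).
rewrite (big_cat_nat (n := j.+1))//=.
have -> : \sum_(j.+1 <= i < n.+1)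
    (B (grid T n i.+1) - B (grid T n i)) * \1_(`[grid T n i, +oo[) s = 0.
  rewrite big_nat_cond big1// => i /andP[/andP[ji iltn] _].
  by rewrite indicE mem_setE in_itv/= andbT ij// ltnNge ji/= mulr0.
have -> : \sum_(0 <= i < j.+1)
    (B (grid T n i.+1) - B (grid T n i)) * \1_(`[grid T n i, +oo[) s
    = \sum_(0 <= i < j.+1) (B (grid T n i.+1) - B (grid T n i)).
  apply: eq_big_nat => i /andP[_ ilt].
  by rewrite indicE mem_setE in_itv/= andbT ij ?ilt ?mulr1//; exact: leq_trans ilt _.
by rewrite telescope_sumr// grid0 addr0 addrC subrK.
Qed.

Lemma within_continuous_dist (A : set R) B x e : {within A, continuous B} ->
  A x -> 0 < e -> exists2 d, 0 < d & forall u, A u -> `|x - u| < d -> `|B x - B u| < e.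
Proof.
move=> /subspace_continuousP cB Ax e0.
have /cvgrPdist_lt /(_ e e0) := cB x Ax.
by move=> /nbhs_ballP[d /= d0 dP]; exists d => // u Au xu; exact: dP.
Qed.

(** By [step_pathE] the step path takes the values of [B] at points within one
    cell of [s]; uniformity comes from the compactness of [0, T]. *)
Lemma step_path_cvg T B e : 0 < T -> {within `[0, T], continuous B} -> 0 < e ->
  \forall n \near \oo, forall s, 0 <= s <= T -> `|B s - step_path T n B s| <= e.
Proof.
move=> T0 cB e0.
have /compact_near_coveringP cov := @segment_compact R 0 T.
suff [N _ NP] : \forall n \near \oo, `[0, T] `<=`
    (fun s => 0 <= s <= T -> `|B s - step_path T n B s| <= e).
  by exists N => // n /NP nP s s0T; apply: nP => //=; rewrite in_itv.
apply: cov => x xT.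
have e20 : 0 < e / 2 by rewrite divr_gt0.
have [d d0 dP] := within_continuous_dist cB xT e20.
have [N _ NP] : \forall n \near \oo, T / n.+1%:R < d / 2.
  have : (fun n : nat => T * n.+1%:R^-1) @ \oo --> T * 0.
    by apply: cvgM; [exact: cvg_cst|exact: cvg_harmonic].
  rewrite mulr0 => /cvgrPdist_lt /(_ (d / 2)).
  rewrite divr_gt0// => /(_ isT); apply: filterS => n.
  by rewrite sub0r normrN; exact: le_lt_trans (ler_norm _).
exists (ball x (d / 2), [set n | (N <= n)%N]).
  by split => /=; [apply: nbhsx_ballx; rewrite divr_gt0|exists N].
move=> [s n] [/= xs Nn] s0T.
have [u [u0T su ->]] := step_pathE n B T0 s0T.
have hxs : `|B x - B s| < e / 2.
  by apply: dP; rewrite /= ?in_itv// (lt_trans xs)// ltr_pdivrMr//; lra.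
have hxu : `|B x - B u| < e / 2.
  apply: dP; rewrite /= ?in_itv//.
  have -> : x - u = x - s + (s - u) by ring.
  rewrite (le_lt_trans (ler_normD _ _))// (splitr d) ltrD//.
  exact: le_lt_trans su (NP n Nn).
have := ler_normD (B x - B u) (- (B x - B s)).
have -> : B x - B u + - (B x - B s) = B s - B u by ring.
by rewrite normrN; lra.
Qed.

End step_path.

(** * The kernel of the system *)

Section kernel.
Context {R : realType}.
Variables (a b : R).

(** The convolution of [exp (- a u)] and [exp (- b u)] on the half line: the
    response of [Y] at time [u] to a unit impulse of the noise at time 0. *)
Definition ou_kernel (u : R) : R :=
  if a == b then u * expR (- (a * u))
  else (expR (- (b * u)) - expR (- (a * u))) / (a - b).

(** The derivative of the kernel, in the form of the differential equation that
    it solves; it covers the two cases of [ou_kernel] at once. *)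
Definition ou_dkernel (u : R) : R := - a * ou_kernel u + expR (- (b * u)).

Lemma is_derive_expRN (c u : R) :
  is_derive u 1 (fun v : R => expR (- (c * v))) (- c * expR (- (c * u))).
Proof.
have d1 : is_derive u 1 (fun v : R => - (c * v)) (- c).
  by apply: is_derive_eq; rewrite /GRing.scale/=; ring.
apply: (is_derive_eq (is_derive1_comp (is_derive_expR _) d1)).
exact: mulrC.
Qed.

Lemma is_derive_ou_kernel (u : R) : is_derive u 1 ou_kernel (ou_dkernel u).
Proof.
have ea := is_derive_expRN a u; have eb := is_derive_expRN b u.
rewrite /ou_dkernel /ou_kernel; case: ifPn => [/eqP <-|ab].
  by apply: is_derive_eq; rewrite /GRing.scale/=; ring.
have abne : a - b != 0 by rewrite subr_eq0.
apply: is_derive_eq; rewrite /GRing.scale/=; field.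
exact: abne.
Qed.

Lemma ou_kernel_continuous : continuous ou_kernel.
Proof.
move=> u; apply/differentiable_continuous/derivable1_diffP.
by case: (is_derive_ou_kernel u).
Qed.

Lemma expRN_continuous (c : R) : continuous (fun v : R => expR (- (c * v))).
Proof.
move=> u; apply/differentiable_continuous/derivable1_diffP.
by case: (is_derive_expRN c u).
Qed.

Lemma ou_dkernel_continuous : continuous ou_dkernel.
Proof.
move=> u; apply: (@cvgD _ R^o); last exact: expRN_continuous.
by apply: cvgM; [exact: cvg_cst|exact: ou_kernel_continuous].
Qed.

Lemma ou_kernel0 : ou_kernel 0 = 0.
Proof.
by rewrite /ou_kernel; case: ifP => _; rewrite ?mul0r// !mulr0 subrr mul0r.
Qed.

End kernel.

(** * Calculus on segments and solution of the system *)

Section paths.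
Context {R : realType}.
Notation mu := (@lebesgue_measure R).

Lemma within_half_line_at (f : R -> R) (s : R) :
  {within `[0, +oo[, continuous f} -> 0 < s -> {for s, continuous f}.
Proof.
by move=> /continuous_within_itvcyP[cf _] s0; apply: cf; rewrite in_itv/= s0.
Qed.

Lemma within_half_line_segment (f : R -> R) (t : R) :
  {within `[0, +oo[, continuous f} -> {within `[0, t], continuous f}.
Proof.
apply: continuous_subspaceW => s /=; rewrite !in_itv/= andbT.
by case/andP.
Qed.

Lemma within_segment_integrable (f : R -> R) (t : R) :
  {within `[0, t], continuous f} -> mu.-integrable `[0, t] (EFin \o f).
Proof. by move=> cf; apply: continuous_compact_integrable => //; exact: segment_compact. Qed.

Lemma is_derive_primitive (f : R -> R) (s : R) :
  {within `[0, +oo[, continuous f} -> 0 < s ->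
  is_derive s 1 (fun v => \int[mu]_(r in `[0, v]) f r) (f s).
Proof.
move=> cf s0.
have s1 : s < s + 1 by rewrite ltrDl.
have fi := within_segment_integrable (within_half_line_segment (t := s + 1) cf).
have [d1 d2] := continuous_FTC1_closed s1 fi s0 (within_half_line_at cf s0).
by apply: DeriveDef => //; rewrite -derive1E.
Qed.

Lemma primitive_continuous (f : R -> R) (t : R) : 0 <= t ->
  {within `[0, +oo[, continuous f} ->
  {within `[0, t], continuous (fun v => \int[mu]_(r in `[0, v]) f r)}.
Proof.
move=> t0 cf.
have fi := within_segment_integrable (within_half_line_segment (t := t) cf).
exact: parameterized_integral_continuous t0 fi.
Qed.

Lemma Rintegral_FTC2 (f F : R -> R) (s t : R) : s < t ->
  {within `[s, t], continuous f} -> {within `[s, t], continuous F} ->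
  (forall v, s < v < t -> is_derive v 1 F (f v)) ->
  \int[mu]_(v in `[s, t]) f v = F t - F s.
Proof.
move=> st cf cF dF; rewrite /Rintegral (@continuous_FTC2 _ f F)//.
  have [_ Fs Ft] := (continuous_within_itvP _ st).1 cF.
  by split=> // v; rewrite in_itv/= => /dF[].
by move=> v; rewrite in_itv/= => /dF[_]; rewrite -derive1E.
Qed.

Lemma Rintegral_segment0 (f : R -> R) : \int[mu]_(v in `[0, 0]) f v = 0.
Proof. by rewrite set_itv1 Rintegral_set1. Qed.

Lemma Rintegral_segment_cst (c t : R) : 0 <= t ->
  \int[mu]_(s in `[0, t]) c = c * t.
Proof.
move=> t0; rewrite Rintegral_cst//; congr (_ * _).
apply: (etrans (congr1 fine (lebesgue_measure_itv `[0, t]))).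
rewrite /= lte_fin; case: ltP => [_|t0']; first by rewrite /= subr0.
by apply/eqP; rewrite eq_le t0.
Qed.

Lemma Rintegral_half_line (f : R -> R) (s t : R) : 0 <= s ->
  \int[mu]_(r in `[0, t]) (f r * \1_(`[s, +oo[) r) = \int[mu]_(r in `[s, t]) f r.
Proof.
move=> s0; have -> : [set` `[s, t]] = [set` `[0, t]] `&` [set` `[s, +oo[].
  apply/seteqP; split => r /=; rewrite !in_itv/= andbT.
    by move=> /andP[sr ->]; rewrite sr (le_trans s0 sr).
  by move=> [/andP[_ ->] ->].
rewrite Rintegral_mkcondr; apply: eq_Rintegral => r _.
by rewrite patchE indicE; case: ifP => _; rewrite ?mulr1 ?mulr0.
Qed.

Lemma continuous_sum_ord n (F : 'I_n -> R -> R) : (forall i, continuous (F i)) ->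
  continuous (fun t => \sum_(i < n) F i t).
Proof.
elim: n F => [|n IH] F cF t.
  have -> : (fun t => \sum_(i < 0) F i t) = cst 0.
    by apply/funext => s; rewrite big_ord0.
  exact: cvg_cst.
have -> : (fun t => \sum_(i < n.+1) F i t)
    = (fun t => \sum_(i < n) F (widen_ord (leqnSn n) i) t + F ord_max t).
  by apply/funext => s; rewrite big_ord_recr.
apply: (@cvgD _ R^o); last exact: cF.
exact: (IH (fun i => F (widen_ord (leqnSn n) i))).
Qed.

Lemma continuous_segment_integrable (g : R -> R) (t : R) :
  continuous g -> mu.-integrable `[0, t] (EFin \o g).
Proof. by move=> cg; apply: within_segment_integrable; exact: continuous_subspaceT. Qed.

Lemma Rintegral_sum_ord n (F : 'I_n -> R -> R) (t : R) :
  (forall i, mu.-integrable `[0, t] (EFin \o F i)) ->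
  mu.-integrable `[0, t] (EFin \o (fun s => \sum_(i < n) F i s)) /\
  \int[mu]_(s in `[0, t]) (\sum_(i < n) F i s)
    = \sum_(i < n) \int[mu]_(s in `[0, t]) F i s.
Proof.
elim: n F => [|n IH] F iF.
  rewrite big_ord0; split.
    apply: eq_integrable (integrable0 _ _) => // s _ /=.
    by rewrite big_ord0.
  by under eq_Rintegral do rewrite big_ord0; rewrite Rintegral_cst// mul0r.
have [i1 i2] := IH (fun i => F (widen_ord (leqnSn n) i)) (fun i => iF _).
split.
  apply: eq_integrable (integrableD _ i1 (iF ord_max)) => // s _ /=.
  by rewrite big_ord_recr.
under eq_Rintegral do rewrite big_ord_recr/=.
by rewrite RintegralD// i2 big_ord_recr.
Qed.

Lemma Rintegral_dist_le (T : R) (g h k : R -> R) :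
  mu.-integrable `[0, T] (EFin \o g) -> mu.-integrable `[0, T] (EFin \o h) ->
  mu.-integrable `[0, T] (EFin \o k) ->
  (forall t, 0 <= t <= T -> `|g t - h t| <= k t) ->
  `|\int[mu]_(t in `[0, T]) g t - \int[mu]_(t in `[0, T]) h t|
    <= \int[mu]_(t in `[0, T]) k t.
Proof.
move=> ig ih ik gh; rewrite -RintegralB//.
have igh : mu.-integrable `[0, T] (EFin \o (fun t => g t - h t)).
  exact: integrableB ig ih.
rewrite (le_trans (le_normr_Rintegral _ igh))//.
by apply: le_Rintegral => //; exact: integrable_norm igh.
Qed.

(** Variation of constants without stochastic integral.  The process
    [V = X - B] is differentiable, and
    [M s = exp (- b (t - s)) * Y s + k (t - s) * V s] has the derivative
    [k' (t - s) * B s], [k] being the kernel: the terms in [X] and [Y] cancel by the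
    equation that [k] solves.
    Integrate from 0 to [t], where [M t = Y t] because [k 0 = 0]. *)
Lemma ou_path_representation (a b x y : R) (X Y B : R -> R) (t : R) :
  {within `[0, +oo[, continuous X} -> {within `[0, +oo[, continuous Y} ->
  {within `[0, +oo[, continuous B} ->
  (forall s, 0 <= s -> X s = x + \int[mu]_(r in `[0, s]) (- a * X r) + B s) ->
  (forall s, 0 <= s -> Y s = y + \int[mu]_(r in `[0, s]) (- b * Y r)
    + \int[mu]_(r in `[0, s]) X r) ->
  0 <= t ->
  Y t = expR (- (b * t)) * y + ou_kernel a b t * x
    + \int[mu]_(s in `[0, t]) (ou_dkernel a b (t - s) * B s).
Proof.
move=> cX cY cB eX eY; rewrite le_eqVlt => /predU1P[<-|t0].
  rewrite ou_kernel0 Rintegral_segment0 mulr0 oppr0 expR0 mul0r mul1r !addr0.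
  by rewrite eY// !Rintegral_segment0 !addr0.
have cXa : {within `[0, +oo[, continuous (fun r => - a * X r)}.
  by move=> r; apply: cvgM; [exact: cvg_cst|exact: cX].
have cYb : {within `[0, +oo[, continuous (fun r => - b * Y r)}.
  by move=> r; apply: cvgM; [exact: cvg_cst|exact: cY].
(* [V] and [W] are [X - B] and [Y], written as primitives to be differentiated. *)
pose V (s : R) := x + \int[mu]_(r in `[0, s]) (- a * X r).
pose W (s : R) := y + \int[mu]_(r in `[0, s]) (- b * Y r) + \int[mu]_(r in `[0, s]) X r.
have dV (s : R) : 0 < s -> is_derive s 1 V (- a * X s).
  move=> s0; have d1 := is_derive_primitive cXa s0.
  by apply: (is_derive_eq (is_deriveD (is_derive_cst x s 1) d1)); rewrite add0r.
have dW (s : R) : 0 < s -> is_derive s 1 W (- b * Y s + X s).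
  move=> s0; have d1 := is_derive_primitive cYb s0.
  have d2 := is_derive_primitive cX s0.
  apply: (is_derive_eq (is_deriveD (is_deriveD (is_derive_cst y s 1) d1) d2)).
  by rewrite add0r.
pose phi (s : R) := expR (- (b * (t - s))).
pose psi (s : R) := ou_kernel a b (t - s).
have dts (s : R) : is_derive s 1 (fun v : R => t - v) (-1).
  by apply: (is_derive_eq (is_deriveB (is_derive_cst t s 1) (is_derive_id s 1))); rewrite add0r.
have dphi (s : R) : is_derive s 1 phi (b * phi s).
  have -> : b * phi s = - b * expR (- (b * (t - s))) * -1 by rewrite /phi; ring.
  exact: (@is_derive1_comp R (fun v : R => expR (- (b * v))) (fun v : R => t - v)
    s _ _ (is_derive_expRN b (t - s)) (dts s)).
have dpsi (s : R) : is_derive s 1 psi (- ou_dkernel a b (t - s)).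
  rewrite -mulrN1.
  exact: (@is_derive1_comp R (ou_kernel a b) (fun v : R => t - v)
    s _ _ (is_derive_ou_kernel a b (t - s)) (dts s)).
pose M (s : R) := phi s * W s + psi s * V s.
have cont_of_derive (g dg : R -> R) : (forall s : R, is_derive s 1 g (dg s)) -> continuous g.
  by move=> gP s; apply/differentiable_continuous/derivable1_diffP; case: (gP s).
have cphi : continuous phi := cont_of_derive _ _ dphi.
have cpsi : continuous psi := cont_of_derive _ _ dpsi.
have cV : {within `[0, t], continuous V}.
  move=> s; apply: (@cvgD _ R^o); first exact: cvg_cst.
  exact: (primitive_continuous (ltW t0) cXa).
have cW : {within `[0, t], continuous W}.
  move=> s; apply: (@cvgD _ R^o); last exact: (primitive_continuous (ltW t0) cX).
  apply: (@cvgD _ R^o); first exact: cvg_cst.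
  exact: (primitive_continuous (ltW t0) cYb).
have cM : {within `[0, t], continuous M}.
  move=> s; apply: (@cvgD _ R^o); apply: cvgM.
  - exact: continuous_subspaceT cphi _.
  - exact: cW.
  - exact: continuous_subspaceT cpsi _.
  - exact: cV.
have cts : continuous (fun s : R => t - s) := cont_of_derive _ _ dts.
have dM (s : R) : 0 < s < t -> is_derive s 1 M (ou_dkernel a b (t - s) * B s).
  move=> /andP[s0 st].
  have dphiW := is_deriveM (dphi s) (dW s s0).
  have dpsiV := is_deriveM (dpsi s) (dV s s0).
  apply: (is_derive_eq (is_deriveD dphiW dpsiV)); rewrite /GRing.scale/=.
  have -> : W s = Y s by rewrite eY// ltW.
  have -> : V s = X s - B s by rewrite eX ?ltW// /V; ring.
  by rewrite /ou_dkernel /phi /psi; ring.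
have cM' : {within `[0, t], continuous (fun s => ou_dkernel a b (t - s) * B s)}.
  move=> s; apply: cvgM; last exact: (within_half_line_segment cB).
  apply: (@continuous_subspaceT _ _ _ (fun s => ou_dkernel a b (t - s))) => {}s.
  exact: (@continuous_comp _ _ _ (fun s => t - s) (ou_dkernel a b) s
    (cts s) (@ou_dkernel_continuous _ a b _)).
rewrite (Rintegral_FTC2 t0 cM' cM dM).
rewrite /M /phi /psi /V /W !subrr !subr0 ou_kernel0 mulr0 oppr0 expR0 !Rintegral_segment0.
by rewrite eY ?ltW//; ring.
Qed.

End paths.

(** * Size of the kernel *)

Section kernel_bounds.
Context {R : realType}.
Notation mu := (@lebesgue_measure R).
Variables (a b : R).
Hypotheses (a0 : 0 < a) (b0 : 0 < b).

Let m := Num.min a b.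
Let delta := `|a - b|.

(** The integral of [exp (- |a - b| u)] over [0, T]. *)
Definition ou_spread (T : R) : R :=
  if a == b then T else (1 - expR (- (`|a - b| * T))) / `|a - b|.

(** The bound on the displacement of the integral of [Y] over [0, T] caused by a
    unit impulse of the noise. *)
Definition ou_gain (T : R) : R :=
  ou_spread T * ((1 - expR (- (Num.min a b * T))) / Num.min a b).

Let m0 : 0 < m. Proof. by rewrite lt_min a0. Qed.

(** Factoring out the slower exponential removes the case distinction on which of
    [a] and [b] is smaller, and exhibits an increasing factor. *)
Lemma ou_kernelE u : ou_kernel a b u = expR (- (m * u)) * ou_spread u.
Proof.
rewrite /ou_kernel /ou_spread /m; case: ifPn => [/eqP <-|ab].
  by rewrite minxx mulrC.
have abne : a - b != 0 by rewrite subr_eq0.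
have [ltab|leba] := ltP a b.
  rewrite ltr0_norm ?subr_lt0//.
  have -> : - (b * u) = - (a * u) + - (- (a - b) * u) by ring.
  by rewrite expRD; field.
have ltba : b < a by rewrite lt_neqAle eq_sym ab.
rewrite gtr0_norm ?subr_gt0//.
have -> : - (a * u) = - (b * u) + - ((a - b) * u) by ring.
by rewrite expRD; field.
Qed.

Lemma ou_spread_homo : {homo ou_spread : u w / u <= w}.
Proof.
move=> u w uw; rewrite /ou_spread; case: ifPn => // ab.
have d0 : 0 < `|a - b| by rewrite normr_gt0 subr_eq0.
by rewrite ler_pM2r ?invr_gt0// lerD2l lerN2 ler_expR lerN2 ler_wpM2l.
Qed.

Lemma ou_spread0 : ou_spread 0 = 0.
Proof. by rewrite /ou_spread mulr0 oppr0 expR0 subrr mul0r; case: ifP. Qed.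

Lemma ou_spread_gt0 T : 0 < T -> 0 < ou_spread T.
Proof.
move=> T0; rewrite /ou_spread; case: ifPn => // ab.
have d0 : 0 < `|a - b| by rewrite normr_gt0 subr_eq0.
by rewrite divr_gt0// subr_gt0 -[ltRHS]expR0 ltr_expR oppr_lt0 mulr_gt0.
Qed.

Lemma ou_gain_gt0 T : 0 < T -> 0 < ou_gain T.
Proof.
move=> T0; rewrite /ou_gain mulr_gt0 ?ou_spread_gt0// divr_gt0//.
by rewrite subr_gt0 -[ltRHS]expR0 ltr_expR oppr_lt0 mulr_gt0.
Qed.

Lemma ou_kernel_ge0 u : 0 <= u -> 0 <= ou_kernel a b u.
Proof.
by move=> u0; rewrite ou_kernelE mulr_ge0 ?expR_ge0// -ou_spread0 ou_spread_homo.
Qed.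

Lemma ou_kernel_le T u : u <= T -> ou_kernel a b u <= ou_spread T * expR (- (m * u)).
Proof. by move=> uT; rewrite ou_kernelE mulrC ler_wpM2r ?expR_ge0// ou_spread_homo. Qed.

Lemma ou_dkernel_le T u : 0 <= u <= T ->
  `|ou_dkernel a b u| <= a * ou_spread T + 1.
Proof.
move=> /andP[u0 uT]; rewrite /ou_dkernel (le_trans (ler_normD _ _))// lerD//.
  rewrite normrM normrN (gtr0_norm a0) ler_pM2l// ger0_norm ?ou_kernel_ge0//.
  rewrite (le_trans (ou_kernel_le uT))// ler_piMr//.
    by rewrite -ou_spread0 ou_spread_homo// (le_trans u0).
  by rewrite -[leRHS]expR0 ler_expR oppr_le0 mulr_ge0// ltW.
by rewrite ger0_norm ?expR_ge0// -[leRHS]expR0 ler_expR oppr_le0 mulr_ge0// ltW.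
Qed.

(** The response at time [t] to an impulse at time [s].  The truncation of
    [t - s] makes it continuous in [t], since the kernel vanishes at 0. *)
Definition ou_kernel_from (s t : R) : R := ou_kernel a b (Num.max (t - s) 0).

Lemma ou_kernel_from_continuous s : continuous (ou_kernel_from s).
Proof.
move=> t; apply: (@continuous_comp _ _ _ (fun t => Num.max (t - s) 0) (ou_kernel a b)).
  apply: continuous_max; last exact: cvg_cst.
  by apply: (@cvgB _ R^o); [exact: cvg_id|exact: cvg_cst].
exact: ou_kernel_continuous.
Qed.

Lemma ou_kernel_from_ge0 s t : 0 <= ou_kernel_from s t.
Proof. by apply: ou_kernel_ge0; rewrite le_max lexx orbT. Qed.

Lemma ou_kernel_from0 s t : t <= s -> ou_kernel_from s t = 0.
Proof. by move=> ts; rewrite /ou_kernel_from max_r ?ou_kernel0// subr_le0. Qed.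

Lemma ou_kernel_fromE s t : s <= t -> ou_kernel_from s t = ou_kernel a b (t - s).
Proof. by move=> st; rewrite /ou_kernel_from max_l// subr_ge0. Qed.

Lemma Rintegral_ou_dkernel (s t : R) : 0 <= s -> 0 <= t ->
  \int[mu]_(r in `[0, t]) (ou_dkernel a b (t - r) * \1_(`[s, +oo[) r)
  = ou_kernel_from s t.
Proof.
move=> s0 t0; rewrite Rintegral_half_line//.
have [st|ts] := ltP s t; last first.
  rewrite ou_kernel_from0//; move: ts; rewrite le_eqVlt => /predU1P[<-|ts].
    by rewrite set_itv1 Rintegral_set1.
  by rewrite set_itv_ge ?Rintegral_set0// bnd_simp -ltNge.
have dts (r : R) : is_derive r 1 (fun v : R => t - v) (-1).
  by apply: (is_derive_eq (is_deriveB (is_derive_cst t r 1) (is_derive_id r 1))); rewrite add0r.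
have cts : continuous (fun v : R => t - v).
  by move=> r; apply: (@cvgB _ R^o); [exact: cvg_cst|exact: cvg_id].
have dF (r : R) : is_derive r 1 (- (ou_kernel a b \o (fun v : R => t - v)))
    (ou_dkernel a b (t - r)).
  have d := @is_derive1_comp R (ou_kernel a b) (fun v : R => t - v)
    r _ _ (is_derive_ou_kernel a b (t - r)) (dts r).
  by apply: (is_derive_eq (is_deriveN d)); rewrite mulrN1 opprK.
have cF : continuous (- (ou_kernel a b \o (fun v : R => t - v))).
  by move=> r; apply/differentiable_continuous/derivable1_diffP; case: (dF r).
have cf : continuous (fun v : R => ou_dkernel a b (t - v)).
  move=> r; exact: (@continuous_comp _ _ _ (fun s => t - s) (ou_dkernel a b) r
    (cts r) (@ou_dkernel_continuous _ a b _)).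
rewrite (Rintegral_FTC2 st (continuous_subspaceT cf) (continuous_subspaceT cF) (fun v _ => dF v)).
by rewrite !fctE/= subrr ou_kernel0 oppr0 add0r opprK ou_kernel_fromE// ltW.
Qed.

(** The kernel is at most its spread at [T] times the slower exponential, and the
    integral of the latter is largest for an impulse at time 0. *)
Lemma Rintegral_ou_kernel_le (s T : R) : 0 <= s -> 0 < T ->
  \int[mu]_(t in `[0, T]) ou_kernel_from s t <= ou_gain T.
Proof.
move=> s0 T0.
have gT := ou_gain_gt0 T0.
have -> : \int[mu]_(t in `[0, T]) ou_kernel_from s t = \int[mu]_(t in `[s, T]) ou_kernel_from s t.
  rewrite -Rintegral_half_line//; apply: eq_Rintegral => t _.
  rewrite indicE mem_setE in_itv/= andbT; case: (leP s t) => st; rewrite ?mulr1 ?mulr0//.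
  by rewrite ou_kernel_from0// ltW.
have [sT|Ts] := ltP s T; last first.
  move: Ts; rewrite le_eqVlt => /predU1P[<-|Ts].
    by rewrite set_itv1 Rintegral_set1 ltW.
  by rewrite set_itv_ge ?Rintegral_set0 ?ltW// bnd_simp -ltNge.
pose F (t : R) := - (ou_spread T / m) * expR (- (m * (t - s))).
pose f (t : R) := ou_spread T * expR (- (m * (t - s))).
have dts (r : R) : is_derive r 1 (fun v : R => v - s) 1.
  by apply: (is_derive_eq (is_deriveB (is_derive_id r 1) (is_derive_cst s r 1))); rewrite subr0.
have de (r : R) : is_derive r 1 (fun t : R => expR (- (m * (t - s)))) (- m * expR (- (m * (r - s))) * 1).
  exact: (@is_derive1_comp R (fun v : R => expR (- (m * v))) (fun v : R => v - s)
    r _ _ (is_derive_expRN m (r - s)) (dts r)).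
have dF (r : R) : is_derive r 1 F (f r).
  apply: (is_derive_eq (is_deriveZ (- (ou_spread T / m)) (de r))).
  by rewrite /f /GRing.scale/=; field; rewrite gt_eqF.
have ce : continuous (fun t : R => expR (- (m * (t - s)))).
  by move=> r; apply/differentiable_continuous/derivable1_diffP; case: (de r).
have cF : continuous F by move=> r; apply: cvgM; [exact: cvg_cst|exact: ce].
have cf : continuous f by move=> r; apply: cvgM; [exact: cvg_cst|exact: ce].
have ii (g : R -> R) : continuous g -> mu.-integrable `[s, T] (EFin \o g).
  move=> cg; apply: continuous_compact_integrable; first exact: segment_compact.
  exact: continuous_subspaceT.
apply: (@le_trans _ _ (\int[mu]_(t in `[s, T]) f t)).
  apply: le_Rintegral => //; [exact/ii/ou_kernel_from_continuous|exact: ii|].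
  move=> t /=; rewrite in_itv/= => /andP[st tT].
  by rewrite ou_kernel_fromE// ou_kernel_le// (le_trans _ tT)// gerBl.
rewrite (Rintegral_FTC2 sT (continuous_subspaceT cf) (continuous_subspaceT cF) (fun v _ => dF v)).
rewrite /F subrr mulr0 oppr0 expR0 /ou_gain -/m.
have -> : - (ou_spread T / m) * expR (- (m * (T - s))) - - (ou_spread T / m) * 1
  = ou_spread T * ((1 - expR (- (m * (T - s)))) / m) by ring.
rewrite ler_pM2l ?ou_spread_gt0// ler_pM2r ?invr_gt0// lerD2l lerN2 ler_expR lerN2.
by rewrite ler_pM2l// gerBl.
Qed.

End kernel_bounds.

(** * The discretised time average *)

Section discretisation.
Context {R : realType}.
Notation mu := (@lebesgue_measure R).
Variables (a b x y T : R) (f : R -> R).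
Hypotheses (a0 : 0 < a) (b0 : 0 < b) (T0 : 0 < T).
Hypothesis f_lip : forall u v, `|f u - f v| <= 1 * `|u - v|.

(** The process [Y] driven by impulses [z i] at the grid points in place of the
    noise. *)
Definition ou_discrete n (z : nat -> R) (t : R) : R :=
  expR (- (b * t)) * y + ou_kernel a b t * x
  + \sum_(i < n.+1) ou_kernel_from a b (grid T n i) t * z i.

Definition ou_discrete_average n (z : nat -> R) : R :=
  T^-1 * \int[mu]_(t in `[0, T]) f (ou_discrete n z t).

Lemma ou_discrete_continuous n z : continuous (ou_discrete n z).
Proof.
move=> t; apply: (@cvgD _ R^o).
  apply: (@cvgD _ R^o); (apply: cvgM; last exact: cvg_cst).
    exact: expRN_continuous.
  exact: ou_kernel_continuous.
apply: (@continuous_sum_ord R n.+1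
  (fun i t => ou_kernel_from a b (grid T n i) t * z i)) => i r.
by apply: cvgM; [exact: ou_kernel_from_continuous|exact: cvg_cst].
Qed.

Lemma f_continuous : continuous f.
Proof. exact: (lipschitz_continuous f_lip). Qed.

Lemma f_discrete_integrable n z :
  mu.-integrable `[0, T] (EFin \o (fun t => f (ou_discrete n z t))).
Proof.
apply: continuous_segment_integrable => t.
exact: (@continuous_comp _ _ _ (ou_discrete n z) f t
  (@ou_discrete_continuous n z t) (@f_continuous _)).
Qed.

(** Each impulse contributes the integral of its response, which is at most the
    gain whatever the time of the impulse. *)
Lemma ou_discrete_average_lipschitz n z z' :
  `|ou_discrete_average n z - ou_discrete_average n z'|
  <= (ou_gain a b T / T) * \sum_(i < n.+1) `|z i - z' i|.
Proof.
rewrite /ou_discrete_average -mulrBr normrM gtr0_norm ?invr_gt0//.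
rewrite [_ / T]mulrC -mulrA ler_pM2l ?invr_gt0//.
pose k (i : 'I_n.+1) t := ou_kernel_from a b (grid T n i) t * `|z i - z' i|.
have ik0 (i : 'I_n.+1) : mu.-integrable `[0, T] (EFin \o ou_kernel_from a b (grid T n i)).
  exact: continuous_segment_integrable (@ou_kernel_from_continuous _ a b _).
have ik i : mu.-integrable `[0, T] (EFin \o k i).
  exact: integrableZr (ik0 i).
have [isk sk] := Rintegral_sum_ord ik.
apply: (le_trans (Rintegral_dist_le (f_discrete_integrable n z)
  (f_discrete_integrable n z') isk _)).
  move=> t t0T; rewrite (le_trans (f_lip _ _))// mul1r /ou_discrete opprD addrACA subrr add0r.
  rewrite -sumrB (le_trans (ler_norm_sum _ _ _))//; apply: ler_sum => i _.
  by rewrite -mulrBr normrM ger0_norm// ou_kernel_from_ge0.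
rewrite sk mulr_sumr; apply: ler_sum => i _.
rewrite RintegralZr// ler_wpM2r//.
by apply: Rintegral_ou_kernel_le => //; rewrite grid_ge0// ltW.
Qed.

Lemma ou_discrete_average_cyl_measurable n : cyl_measurable (ou_discrete_average n).
Proof.
move=> d S Z mZ; apply: measurable_funM => //.
pose g (p : S * measurableTypeR R) := f (ou_discrete n (fun i => Z i p.1) p.2).
apply: (measurable_Rintegral_param mu (f := g)) => //.
have mc (h : R -> R) : continuous h ->
    measurable_fun setT (fun p : S * measurableTypeR R => h p.2).
  move=> ch; have mh : measurable_fun (setT : set (measurableTypeR R)) h.
    exact: continuous_measurable_fun ch.
  exact: (measurableT_comp mh measurable_snd).
apply: (measurableT_comp (lipschitz_measurable f_lip)).
apply: measurable_funD.
  apply: measurable_funD; apply: measurable_funM => //.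
    exact: (mc _ (@expRN_continuous R b)).
  exact: (mc _ (@ou_kernel_continuous R a b)).
apply: measurable_sum => i; apply: measurable_funM.
  exact: (mc _ (@ou_kernel_from_continuous _ a b _)).
exact: (measurableT_comp (mZ i) measurable_fst).
Qed.

Variables (B Y : R -> R).
Hypotheses (cB : {within `[0, +oo[, continuous B}) (B0 : B 0 = 0).
Hypothesis cY : {within `[0, +oo[, continuous Y}.
Hypothesis YE : forall t, 0 <= t -> Y t = expR (- (b * t)) * y + ou_kernel a b t * x
    + \int[mu]_(s in `[0, t]) (ou_dkernel a b (t - s) * B s).

Let incr n (i : nat) : R := B (grid T n i.+1) - B (grid T n i).

(** The discretised process is what the representation of [Y] gives when [B] is
    replaced by its step path: the integral of [ou_dkernel a b (t - s)] from a grid point to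
    [t] is the response to the impulse there. *)
Lemma ou_discreteE n t : 0 <= t ->
  mu.-integrable `[0, t] (EFin \o (fun s => ou_dkernel a b (t - s) * step_path T n B s)) /\
  ou_discrete n (incr n) t = expR (- (b * t)) * y + ou_kernel a b t * x
    + \int[mu]_(s in `[0, t]) (ou_dkernel a b (t - s) * step_path T n B s).
Proof.
move=> t0.
have cd : continuous (fun v : R => ou_dkernel a b (t - v)).
  move=> r; apply: (@continuous_comp _ _ _ (fun s => t - s) (ou_dkernel a b) r).
    by apply: (@cvgB _ R^o); [exact: cvg_cst|exact: cvg_id].
  exact: (@ou_dkernel_continuous _ a b _).
pose q (i : 'I_n.+1) s := ou_dkernel a b (t - s) * \1_(`[grid T n i, +oo[) s.
have iq i : mu.-integrable `[0, t] (EFin \o q i).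
  apply: (le_integrable _ _ _ (continuous_segment_integrable t cd)) => //.
    apply/measurable_EFinP; apply: measurable_funM.
      by apply: measurable_funTS; exact: continuous_measurable_fun cd.
    by apply: measurable_funTS; exact: measurable_indic.
  move=> s _; rewrite /= lee_fin /q normrM ler_piMr//.
  by rewrite indicE; case: (_ \in _); rewrite ?normr1 ?normr0.
have iqz i : mu.-integrable `[0, t] (EFin \o (fun s => q i s * incr n i)).
  exact: integrableZr (iq i).
have [is1 is2] := Rintegral_sum_ord iqz.
have E s : ou_dkernel a b (t - s) * step_path T n B s = \sum_(i < n.+1) q i s * incr n i.
  rewrite /step_path B0 add0r mulr_sumr; apply: eq_bigr => i _.
  by rewrite /q /incr mulrCA mulrC.
split; first by apply: eq_integrable is1 => // s _ /=; rewrite E.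
under eq_Rintegral do rewrite E.
rewrite is2 /ou_discrete; congr (_ + _); apply: eq_bigr => i _.
by rewrite RintegralZr// Rintegral_ou_dkernel// grid_ge0// ltW.
Qed.

Lemma ou_discrete_dist n t e :
  (forall s, 0 <= s <= T -> `|B s - step_path T n B s| <= e) -> 0 <= t <= T ->
  `|ou_discrete n (incr n) t - Y t| <= (a * ou_spread a b T + 1) * e * T.
Proof.
move=> Be /andP[t0 tT].
have e0 : 0 <= e by rewrite (le_trans _ (Be 0 _))// lexx ltW.
set D := a * ou_spread a b T + 1.
have D0 : 0 <= D by rewrite addr_ge0// mulr_ge0 ?ltW// ou_spread_gt0.
have [istep ->] := ou_discreteE n t0.
rewrite YE// opprD addrACA subrr add0r.
have iB : mu.-integrable `[0, t] (EFin \o (fun s => ou_dkernel a b (t - s) * B s)).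
  apply: within_segment_integrable => s; apply: cvgM.
    apply: (@continuous_subspaceT _ _ _ (fun s => ou_dkernel a b (t - s))) => {}s.
    apply: (@continuous_comp _ _ _ (fun s => t - s) (ou_dkernel a b) s).
      by apply: (@cvgB _ R^o); [exact: cvg_cst|exact: cvg_id].
    exact: (@ou_dkernel_continuous _ a b _).
  exact: within_half_line_segment cB _.
rewrite -RintegralB//.
have id : mu.-integrable `[0, t] (EFin \o (fun s =>
    ou_dkernel a b (t - s) * step_path T n B s - ou_dkernel a b (t - s) * B s)).
  exact: integrableB istep iB.
rewrite (le_trans (le_normr_Rintegral _ id))//.
apply: (@le_trans _ _ (\int[mu]_(s in `[0, t]) (D * e))).
  apply: le_Rintegral => //; first exact: integrable_norm id.
    by apply: continuous_segment_integrable => s; exact: cvg_cst.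
  move=> s /=; rewrite in_itv/= => /andP[s0 st].
  rewrite -mulrBr normrM ler_pM//.
    by apply: ou_dkernel_le => //; rewrite subr_ge0 st/= (le_trans _ tT)// gerBl.
  by rewrite distrC Be// s0 (le_trans st).
by rewrite Rintegral_segment_cst// ler_wpM2l// mulr_ge0.
Qed.

Lemma ou_discrete_average_cvg :
  ou_discrete_average n (incr n) @[n --> \oo] --> T^-1 * \int[mu]_(t in `[0, T]) f (Y t).
Proof.
set D := a * ou_spread a b T + 1.
have D0 : 0 < D by rewrite ltr_wpDl// mulr_ge0 ?ltW// ou_spread_gt0.
have iY : mu.-integrable `[0, T] (EFin \o (fun t => f (Y t))).
  apply: within_segment_integrable => s.
  apply: (@continuous_comp (subspace `[0, T]) _ _ Y f s); last exact: f_continuous.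
  exact: within_half_line_segment cY _.
apply/cvgrPdist_le => e e0.
pose e' := e / (D * T).
have e'0 : 0 < e' by rewrite divr_gt0// mulr_gt0.
have := step_path_cvg T0 (within_half_line_segment cB (t := T)) e'0.
apply: filterS => n nP.
rewrite distrC /ou_discrete_average -mulrBr normrM gtr0_norm ?invr_gt0//.
rewrite ler_pdivrMl//.
have ie : mu.-integrable `[0, T] (EFin \o (fun t : R => e)).
  by apply: continuous_segment_integrable => s; exact: cvg_cst.
apply: (le_trans (Rintegral_dist_le (f_discrete_integrable n _) iY ie _)).
  move=> t t0T; rewrite (le_trans (f_lip _ _))// mul1r.
  have De' : D * e' * T = e by rewrite /e'; field; rewrite !gt_eqF.
  by rewrite (le_trans (ou_discrete_dist nP t0T))// -/D De'.
by rewrite (Rintegral_segment_cst _ (ltW T0)) mulrC.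
Qed.

End discretisation.

(** * The concentration inequality *)

(** The paths are continuous but the process is not assumed jointly measurable.
    Its step paths are, being finite sums of products, and their time averages
    converge for every [w]; an almost sure limit would not be enough, as the
    probability need not be complete. *)
Lemma measurable_time_average (R : realType) d (Omega : measurableType d)
    (P : probability Omega R) (f : R -> R) (Y : R -> {RV P >-> R}) (T : R) :
  0 < T -> (forall u v, `|f u - f v| <= 1 * `|u - v|) ->
  (forall w, {within `[0, +oo[, continuous (fun t => Y t w)}) ->
  measurable_fun setT (time_average f Y T).
Proof.
move=> T0 f_lip cY.
have mf := lipschitz_measurable f_lip.
pose F_ n w := T^-1 *
  \int[lebesgue_measure]_(t in `[0, T]) f (step_path T n (fun t => Y t w) t).
apply: (@measurable_fun_cvg _ _ _ _ F_) => [n|w _].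
  apply: measurable_funM => //.
  pose g (p : Omega * measurableTypeR R) := f (step_path T n (fun t => Y t p.1) p.2).
  apply: (measurable_Rintegral_param lebesgue_measure (f := g)) => //.
  have mY t : measurable_fun setT (fun p : Omega * measurableTypeR R => Y t p.1).
    exact: (measurableT_comp (measurable_funPT (Y t)) measurable_fst).
  apply: (measurableT_comp mf); apply: measurable_funD; first exact: mY.
  apply: measurable_sum => i; apply: measurable_funM.
    by apply: measurable_funB; exact: mY.
  have mi : measurable_fun (setT : set (measurableTypeR R)) (\1_(`[grid T n i, +oo[) : R -> R).
    exact: measurable_indic.
  exact: (measurableT_comp mi measurable_snd).
have cYT := within_half_line_segment (t := T) (cY w).
have iY : lebesgue_measure.-integrable `[0, T] (EFin \o (fun t => f (Y t w))).
  apply: within_segment_integrable => s.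
  apply: (@continuous_comp (subspace `[0, T]) _ _ (fun t => Y t w) f s).
    exact: cYT.
  exact: lipschitz_continuous f_lip _.
apply/cvgrPdist_le => e e0.
have := step_path_cvg T0 cYT e0; apply: filterS => n nP.
have fP t : 0 <= t <= T ->
    `|f (Y t w) - f (step_path T n (fun t => Y t w) t)| <= e.
  by move=> /nP; apply: le_trans; rewrite (le_trans (f_lip _ _))// mul1r.
have ie : lebesgue_measure.-integrable `[0, T] (EFin \o (fun t : R => e)).
  by apply: continuous_segment_integrable => s; exact: cvg_cst.
have istep : lebesgue_measure.-integrable `[0, T]
    (EFin \o (fun t => f (step_path T n (fun t => Y t w) t))).
  apply: (le_integrable _ _ _ (integrableD _ (integrable_norm iY) ie)) => //.
    apply/measurable_EFinP; apply: (measurableT_comp mf).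
    apply: measurable_funD => //; apply: measurable_sum => i.
    exact: measurable_funM.
  move=> t /=; rewrite in_itv/= => /fP h.
  rewrite lee_fin (le_trans _ (ler_norm _))//.
  move: h; set q := f (step_path _ _ _ _) => h.
  have -> : q = f (Y t w) - (f (Y t w) - q) by ring.
  by rewrite (le_trans (ler_normB _ _))// lerD2l.
rewrite /time_average /F_ -mulrBr normrM gtr0_norm ?invr_gt0// ler_pdivrMl//.
apply: (le_trans (Rintegral_dist_le iY istep ie fP)).
by rewrite (Rintegral_segment_cst _ (ltW T0)) mulrC.
Qed.

Lemma concentration_exponentE (R : realType) (a b T r : R) :
  0 < a -> 0 < b -> 0 < T ->
  concentration_exponent a b T r = - (r ^+ 2 / (4 * (ou_gain a b T ^+ 2 / T))).
Proof.
move=> a0 b0 T0.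
have m0 : 0 < Num.min a b by rewrite lt_min a0.
have e0 (c : R) : 0 < c -> 0 < 1 - expR (- (c * T)).
  by move=> c0; rewrite subr_gt0 -[ltRHS]expR0 ltr_expR oppr_lt0 mulr_gt0.
have em := e0 _ m0.
rewrite /concentration_exponent /ou_gain /ou_spread; case: ifPn => [_|ab].
  by field; rewrite !gt_eqF.
have d0 : 0 < `|a - b| by rewrite normr_gt0 subr_eq0.
have ed := e0 _ d0.
by field; rewrite !gt_eqF.
Qed.

Unset Implicit Arguments.

Theorem proposition4p18 (R : realType) (d : measure_display)
    (Omega : measurableType d) (P : probability Omega R)
    (B : R -> {RV P >-> R}) (hB : brownian_motion B)
    (alpha beta : R) (halpha : 0 < alpha) (hbeta : 0 < beta)
    (x y : R) (X Y : R -> {RV P >-> R})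
    (hXY : OU_solution B alpha beta x y X Y)
    (f : R -> R) (hf : 1.-lipschitz f)
    (r T : R) (hr : 0 < r) (hT : 0 < T) :
  (P [set w | r%:E <= (time_average f Y T w)%:E - 'E_P[time_average f Y T]]
    <= (expR (concentration_exponent alpha beta T r))%:E)%E.
Proof.
have f_lip u v : `|f u - f v| <= 1 * `|u - v| by exact: (@hf (u, v) (conj I I)).
set F := time_average f Y T.
have mF : measurable_fun setT F.
  exact: measurable_time_average hT f_lip (OU_contY hXY).
pose C := ou_gain alpha beta T.
have C0 : 0 < C by exact: ou_gain_gt0.
pose K := C ^+ 2 / T.
have K0 : 0 < K by rewrite divr_gt0// exprn_gt0.
pose g n := ou_discrete_average alpha beta x y T f n.
pose Z n i : {RV P >-> R} := B (grid T n i.+1) - B (grid T n i).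
have Zsub n i : subgaussian P (Z n i) (T / n.+1%:R).
  have h0 : 0 < T / n.+1%:R by rewrite divr_gt0.
  have hs : grid T n i < grid T n i.+1 by rewrite -subr_gt0 gridS.
  rewrite -(sqr_sqrtr (ltW h0)) -(gridS T n i).
  apply: distribution_normal_subgaussian; first by rewrite sqrtr_gt0 gridS.
  exact: (brownian_gauss hB (grid_ge0 _ _ (ltW hT)) hs).
have Zindep n k : mutually_independent (fun i : 'I_k => Z n i).
  have h0 : 0 <= grid T n 0 by rewrite grid0.
  exact: (brownian_indep hB h0 (grid_nondecreasing n (ltW hT))).
pose F_ n w := g n (fun i => Z n i w).
have mF_ n : measurable_fun setT (F_ n).
  have cm := ou_discrete_average_cyl_measurable alpha beta x y T f_lip n.
  exact: (cm _ _ (fun i => Z n i) (fun i => measurable_funPT (Z n i))).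
have F_mgf n : exists c, forall l : R,
    (\int[P]_w (expR (l * (F_ n w - c)))%:E <= (expR (l ^+ 2 * K))%:E)%E.
  have [c cP] := lipschitz_mgf_indep (Zindep n) (Zsub n)
    (ou_discrete_average_cyl_measurable alpha beta x y T f_lip n)
    (ou_discrete_average_lipschitz x y halpha hbeta hT f_lip n).
  exists c => l; apply: (le_trans (cP l)).
  suff -> : n.+1%:R * ((ou_gain alpha beta T / T) ^+ 2 * (T / n.+1%:R)) = K by [].
  by rewrite /K /C; field; rewrite gt_eqF// addrC natr1 pnatr_eq0.
have F_F : {ae P, forall w, F_ ^~ w @ \oo --> F w}.
  have aeF : Filter (almost_everywhere P) := ae_filter_ringOfSetsType P.
  apply: filterS3 (brownian_start hB) (brownian_cont hB)
    (filterI (OU_eqX hXY) (OU_eqY hXY)) => w B0 cB [eX eY].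
  have cX := @OU_contX _ _ _ _ _ _ _ _ _ _ _ hXY w.
  have cY := @OU_contY _ _ _ _ _ _ _ _ _ _ _ hXY w.
  have YE t := ou_path_representation (t := t) cX cY cB eX eY.
  exact: (ou_discrete_average_cvg halpha hbeta hT f_lip cB B0 cY YE).
have [iF FP] := subgaussian_limit mF_ mF F_F (ltW K0) F_mgf.
have EF : ('E_P[F] = (\int[P]_w F w)%R%:E)%E.
  by rewrite unlock /Rintegral fineK//; exact: (integrable_fin_num measurableT iF).
rewrite EF concentration_exponentE//.
apply: le_trans (subgaussian_tail mF K0 hr FP).
by under eq_set => w do rewrite -EFinB lee_fin.
Qed.
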